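(* Let $I\subseteq\{2,3,4,\dots\}$ be finite with $2\in I$ and $I\neq\{2\}$, and let $h=\dim_{\mathrm H}\mathcal{B}_I$. Then $$\dim_{\mathrm A}^\theta\mathcal{B}_I=\begin{cases}h+\frac{\theta}{1-\theta}(1-h),&0\le\theta<1/2,\\ 1,&1/2\le\theta<1.\end{cases}$$
   Context: For $I\subseteq\{2,3,4,\dots\}$, $$\mathcal{B}_I=\left\{z\in(0,1)\setminus\mathbb{Q}:\ z=1-\cfrac{1}{b_1-\cfrac{1}{b_2-\cfrac{1}{\ddots}}},\ b_n\in I\text{ for all }n\in\mathbb{N}\right\}$$ (backwards continued fractions with digits in $I$). $\dim_{\mathrm H}$ and $\overline{\dim}_{\mathrm B}$ are Hausdorff and upper box dimension. For a non-empty bounded set $E\subset\mathbb{R}$ and $\theta\in(0,1)$, the Assouad spectrum is $\dim_{\mathrm A}^\theta E=\inf\{\alpha:\exists C>0\ \forall x\in E\ \forall\,0<R\le1,\ N_{R^{1/\theta}}(B(x,R)\cap E)\le CR^{\alpha(1-1/\theta)}\}$, where $B(x,R)$ is the open ball and $N_r(\cdot)$ is the smallest number of balls of radius $r$ needed to cover a set; by convention $\dim_{\mathrm A}^0E=\overline{\dim}_{\mathrm B}E$. *)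

(* Defs.v *)
From mathcomp Require Import all_boot all_order all_algebra.
From mathcomp Require Import all_classical all_reals all_analysis.
Import Order.TTheory GRing.Theory Num.Theory.
Import numFieldNormedType.Exports.

Set Implicit Arguments.
Unset Strict Implicit.
Unset Printing Implicit Defensive.

Local Open Scope classical_set_scope.
Local Open Scope ring_scope.

(* b 0 - 1/(b 1 - 1/( ... - 1/(b n))), with digits numbered from 0. When all
   digits are at least 2 every partial denominator is greater than 1, so no
   division by zero occurs. *)
Fixpoint bcf_tail (R : realType) (b : nat -> nat) (n : nat) : R :=
  match n with
  | 0%N => (b 0%N)%:R
  | m.+1 => (b 0%N)%:R - (bcf_tail R (fun k => b k.+1) m)^-1
  end.

(* The infinite continued fraction is the limit of its finite truncations. *)
Definition backward_cf_set (R : realType) (I : set nat) : set R :=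
  [set z : R | 0 < z < 1 /\ irrational z /\
    exists b : nat -> nat, (forall n, I (b n)) /\
      (1 - (bcf_tail R b n)^-1 @[n --> \oo] --> z)].
Arguments backward_cf_set : clear implicits.

Local Open Scope ereal_scope.

(* diam set0 = -oo *)
Definition diam (R : realType) (A : set R) : \bar R :=
  ereal_sup [set (`|x - y|%R)%:E | x in A & y in A].

(* |A|^s; the empty set has weight 0 for every s, including s = 0. *)
Definition diam_pow (R : realType) (s : R) (A : set R) : \bar R :=
  if A == set0 then 0 else poweR (diam A) s.

Definition hausdorff_premeasure (R : realType) (s delta : R) (E : set R) :
    \bar R :=
  ereal_inf [set \sum_(0 <= i <oo) diam_pow s (U i) | U in
    [set U : nat -> set R | (forall i, diam (U i) <= delta%:E) /\
                            E `<=` \bigcup_i U i]].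

Definition hausdorff_measure (R : realType) (s : R) (E : set R) : \bar R :=
  ereal_sup [set hausdorff_premeasure s delta E | delta in
    [set delta : R | (0 < delta)%R]].

Definition hausdorff_dim (R : realType) (E : set R) : \bar R :=
  ereal_inf [set s%:E | s in
    [set s : R | (0 <= s)%R /\ hausdorff_measure s E = 0]].

(* Least number of open balls of radius r covering E, the centres being
   arbitrary reals; +oo if no finite cover exists. *)
Definition covering_number (R : realType) (r : R) (E : set R) : \bar R :=
  ereal_inf [set (n%:R : R)%:E | n in
    [set n : nat | exists c : 'I_n -> R, E `<=` \bigcup_i ball (c i) r]].

Definition upper_box_dim (R : realType) (E : set R) : \bar R :=
  limf_esup (fun r : R => lne (covering_number r E) * ((- ln r)^-1)%:E)
            (0%R : R)^'+.

(* Meaningful for 0 <= theta < 1; theta = 0 is the upper box dimension by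
   convention. *)
Definition assouad_spectrum (R : realType) (theta : R) (E : set R) : \bar R :=
  if theta == 0%R then upper_box_dim E
  else ereal_inf [set alpha%:E | alpha in [set alpha : R |
    exists C : R, (0 < C)%R /\
      forall x : R, E x -> forall rho : R, (0 < rho <= 1)%R ->
        covering_number (rho `^ theta^-1) (ball x rho `&` E)
          <= (C * rho `^ (alpha * (1 - theta^-1)))%:E]].

(* Main.v *)
(* The set E is the limit set of the branches phi_b(x) = 1 - 1/(b - 1 + x), all
   contracting except phi_2, whose fixed point 0 is neutral: phi_2^n has
   derivative about n^-2.  Grouping digits into blocks 2^n b with b >= 3 restores
   bounded distortion: every word w of blocks has a ratio L_w that is the
   contraction rate of phi_w up to a factor 4.

   If finitely many words of the same number of blocks satisfy
   sum (L_w/4)^t >= 1, a descent in the tree of these words shows h >= t.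
   One-block words give h >= 1/2, since sum n^(-2t) diverges for t < 1/2.
   Conversely, for t > h the sums of L_w^t over the words with k blocks are
   bounded uniformly in k, hence sum L_w^t' over all words converges for t' > t.
   A point of E whose longest block prefix with L_w >= r is w lies in an interval
   of length about (r L_w)^(1/2) next to phi_w(0), so N_r(E) is at most a constant
   times sum (L_w/r)^(1/2) <= C r^-t', and the upper box dimension is h.

   For the Assouad spectrum, strip from the points of a ball of radius rho their
   common blocks.  The rest meets a run of pieces of sizes n^-2 with total length
   about rho, and adding up the box counts of the pieces gives
   N_r <= C r^-t rho^(2t-1) when r <= rho^2 and 1/2 < t <= 1.  Conversely a ball
   of radius rho close to 0 contains about 1/rho pieces of size rho^2: if
   r <= rho^2 they must be covered one by one, and if r >= rho^2 they are r-dense. *)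
Require Import Defs.
From mathcomp Require Import all_boot all_order all_algebra.
From mathcomp Require Import all_classical all_reals all_analysis.
From mathcomp Require Import ring lra.
Import Order.TTheory GRing.Theory Num.Theory.
Import numFieldNormedType.Exports.

Set Implicit Arguments.
Unset Strict Implicit.
Unset Printing Implicit Defensive.

Local Open Scope classical_set_scope.
Local Open Scope ring_scope.

(** * Inverse branches *)

Section BranchMaps.
Variable R : realType.
Implicit Types (b n : nat) (w u : seq nat) (x y : R).

Definition bmap b x : R := 1 - (b%:R - 1 + x)^-1.

Definition wmap w x : R := foldr bmap x w.

(* Bottom row (r, s) of the Moebius matrix of wmap w: the derivative of wmap w
   at x is (s + r x)^-2. *)
Definition wden w : R * R :=
  foldl (fun p b => (p.1 + p.2, (b%:R - 2) * p.1 + (b%:R - 1) * p.2)) (0, 1) w.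

(** This is the derivative of [wmap w] at 0, its largest value on the nonnegative half-line because
    the bottom row is nonnegative. It plays the role of L_w. *)
Definition wratio w : R := (wden w).2 ^- 2.

(** For words satisfying [hyp] this is the number of blocks, since every block contains exactly one
    digit other than 2. *)
Definition rank w : nat := count (predC1 2%N) w.

(* Words with bounded distortion: they do not end at the neutral digit 2. *)
Definition hyp w := all (leq 2) w && (last 3 w != 2)%N.

Definition blk n b : seq nat := rcons (nseq n 2%N) b.

Lemma natr_ge2 b : (2 <= b)%N -> (2 : R) <= b%:R.
Proof. by move=> hb; rewrite ler_nat. Qed.

Lemma bmap_sub b x y : (2 <= b)%N -> 0 <= x -> 0 <= y ->
  bmap b x - bmap b y = (x - y) / ((b%:R - 1 + x) * (b%:R - 1 + y)).
Proof.
move=> /natr_ge2 hb hx hy; rewrite /bmap; field.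
by apply/andP; split; rewrite gt_eqF //; lra.
Qed.

Lemma bmap_ge0 b x : (2 <= b)%N -> 0 <= x -> 0 <= bmap b x.
Proof.
move=> /natr_ge2 hb hx; rewrite /bmap subr_ge0 invf_le1; lra.
Qed.

Lemma bmap_lt1 b x : (2 <= b)%N -> 0 <= x -> bmap b x < 1.
Proof.
move=> /natr_ge2 hb hx; rewrite /bmap gtrBl invr_gt0; lra.
Qed.

Lemma bmap_ge_half b x : (3 <= b)%N -> 0 <= x -> 2^-1 <= bmap b x.
Proof.
move=> hb hx; have : (3 : R) <= b%:R by rewrite ler_nat.
move=> hb'; rewrite /bmap lerBrDr -lerBrDl.
rewrite (_ : 1 - 2^-1 = 2^-1 :> R); last by lra.
by rewrite lef_pV2 ?posrE; lra.
Qed.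

Lemma bmap_le b x : (2 <= b)%N -> 0 <= x <= 1 -> bmap b x <= 1 - b%:R^-1.
Proof.
move=> /natr_ge2 hb hx; rewrite /bmap lerD2l lerN2 lef_pV2 ?posrE; lra.
Qed.

Lemma wmap_cat w u x : wmap (w ++ u) x = wmap w (wmap u x).
Proof. by rewrite /wmap foldr_cat. Qed.

Lemma wmap_rcons w b x : wmap (rcons w b) x = wmap w (bmap b x).
Proof. by rewrite -cats1 wmap_cat. Qed.

Lemma wden_rcons w b : wden (rcons w b) =
  ((wden w).1 + (wden w).2, (b%:R - 2) * (wden w).1 + (b%:R - 1) * (wden w).2).
Proof. by rewrite /wden foldl_rcons. Qed.

Lemma wden_ge w : all (leq 2) w -> 0 <= (wden w).1 /\ 1 <= (wden w).2.
Proof.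
elim/last_ind: w => [|w b IH]; first by rewrite /wden /=; lra.
rewrite all_rcons wden_rcons => /andP[/natr_ge2 hb /IH[h1 h2]] /=; split; first lra.
have := mulr_ge0 (_ : 0 <= b%:R - 2 :> R) h1.
have := ler_wpM2l (_ : 0 <= b%:R - 1 :> R) h2; nra.
Qed.

Lemma wmap_ge0 w x : all (leq 2) w -> 0 <= x -> 0 <= wmap w x.
Proof. by elim: w => //= b w IH /andP[hb hw] hx; rewrite bmap_ge0 ?IH. Qed.

(** The matrices of the branches have determinant 1, so the difference quotient of the composed
    Moebius map is the inverse of the product of its denominators at the two points. *)
Lemma wmap_sub w x y : all (leq 2) w -> 0 <= x -> 0 <= y ->
  wmap w x - wmap w y = (x - y) /
   (((wden w).2 + (wden w).1 * x) * ((wden w).2 + (wden w).1 * y)).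
Proof.
elim/last_ind: w x y => [|w b IH] x y.
  by rewrite /wden /= !mul0r !addr0 mulr1 divr1.
rewrite all_rcons wden_rcons => /andP[hb hw] hx hy /=.
rewrite !wmap_rcons IH ?bmap_ge0 // bmap_sub // /bmap.
have [h1 h2] := wden_ge hw.
move: (wden w).1 (wden w).2 h1 h2 => r s h1 h2.
move: hb => /natr_ge2; move: b%:R => {}b hb.
have bx : 0 < b - 1 + x by lra.
have By : 0 < b - 1 + y by lra.
(* Cocycle identity: the denominator of [w] at [bmap b z] times that of the digit [b] at [z] is the
   denominator of [rcons w b] at [z]. *)
have E (z : R) : 0 <= z -> (s + r * (1 - (b - 1 + z)^-1)) * (b - 1 + z) =
   (b - 2) * r + (b - 1) * s + (r + s) * z.
  by move=> hz; field; rewrite gt_eqF //; lra.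
have P (z : R) : 0 <= z -> 0 < (b - 2) * r + (b - 1) * s + (r + s) * z.
  by move=> hz; nra.
have Q (z : R) : 0 <= z -> s + r * (1 - (b - 1 + z)^-1) != 0.
  move=> hz; have := P _ hz; rewrite -E // => /gt_eqF; rewrite mulf_eq0.
  by case/norP.
rewrite -!E //.
have := Q _ hx; have := Q _ hy.
move: (s + r * _) (s + r * _) => A B hA hB; field.
by rewrite hA hB /= !gt_eqF.
Qed.

Lemma wratio_gt0 w : all (leq 2) w -> 0 < wratio w.
Proof. by move=> /wden_ge[_ h]; rewrite /wratio invr_gt0 exprn_gt0; lra. Qed.

Lemma wratio_nil : wratio [::] = 1.
Proof. by rewrite /wratio /wden /= expr1n invr1. Qed.

Lemma wmap_homo w x y : all (leq 2) w -> 0 <= x -> x <= y ->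
  wmap w x <= wmap w y.
Proof.
move=> hw hx xy; rewrite -subr_ge0 wmap_sub //; last lra.
have [h1 h2] := wden_ge hw.
rewrite divr_ge0 ?subr_ge0 // mulr_ge0 // addr_ge0 ?mulr_ge0 //; lra.
Qed.

Lemma wmap_lip w x y : all (leq 2) w -> 0 <= x -> 0 <= y ->
  `|wmap w x - wmap w y| <= wratio w * `|x - y|.
Proof.
move=> hw hx hy; rewrite wmap_sub // normrM mulrC ler_wpM2r //.
have [h1 h2] := wden_ge hw.
have hx' := mulr_ge0 h1 hx; have hy' := mulr_ge0 h1 hy.
rewrite normfV ger0_norm; last by rewrite mulr_ge0 //; lra.
rewrite /wratio lef_pV2 ?posrE ?exprn_gt0 ?mulr_gt0 ?expr2; nra.
Qed.

Lemma hyp_all w : hyp w -> all (leq 2) w.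
Proof. by case/andP. Qed.

(** A last digit b >= 3 gives r + s <= (b - 2) r + (b - 1) s whatever precedes it, whereas a last
    digit 2 lets the first entry grow alone. *)
Lemma wden_hyp w : hyp w -> (wden w).1 <= (wden w).2.
Proof.
elim/last_ind: w => [|w b _]; first by rewrite /wden /= ler01.
rewrite /hyp all_rcons last_rcons wden_rcons => /andP[/andP[hb hw] b2] /=.
have : (3 : R) <= b%:R by rewrite ler_nat ltn_neqAle eq_sym b2.
by have [h1 h2] := wden_ge hw; nra.
Qed.

(** As r <= s, both denominators are at most 2 s on [0, 1]; this is the bounded distortion, and the
    source of the factor 4. *)
Lemma wmap_colip w x y : hyp w -> 0 <= x <= 1 -> 0 <= y <= 1 ->
  wratio w / 4 * `|x - y| <= `|wmap w x - wmap w y|.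
Proof.
move=> hw /andP[hx x1] /andP[hy y1]; rewrite wmap_sub ?hyp_all // normrM mulrC.
rewrite ler_wpM2l //.
have [h1 h2] := wden_ge (hyp_all hw); have h3 := wden_hyp hw.
have hx' := mulr_ge0 h1 hx; have hy' := mulr_ge0 h1 hy.
have hx'' : (wden w).1 * x <= (wden w).1 by rewrite ler_piMr.
have hy'' : (wden w).1 * y <= (wden w).1 by rewrite ler_piMr.
rewrite normfV ger0_norm; last by rewrite mulr_ge0 //; lra.
rewrite /wratio -invfM lef_pV2 ?posrE ?mulr_gt0 ?exprn_gt0 //; try lra.
move: ((wden w).1 * x) ((wden w).1 * y) hx' hy' hx'' hy'' => A B *.
rewrite (_ : _ * 4 = (2 * (wden w).2) * (2 * (wden w).2)); last by ring.
apply: ler_pM; lra.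
Qed.

(** The digit 2 leaves s unchanged and every larger digit at least doubles it. *)
Lemma wratio_rank w : all (leq 2) w -> wratio w <= 4^-1 ^+ rank w.
Proof.
move=> hw; rewrite exprVn /wratio.
rewrite (_ : 4 = 2 * 2 :> R); last by lra.
rewrite -expr2 exprAC lef_pV2 ?posrE ?exprn_gt0 //; last first.
  by have [] := wden_ge hw; lra.
rewrite lerXn2r ?nnegrE ?exprn_ge0 //; first by have [] := wden_ge hw; lra.
elim/last_ind: w hw => [|w b IH]; first by rewrite /wden.
rewrite all_rcons wden_rcons => /andP[hb hw] /=.
have [h1 h2] := wden_ge hw; have {}IH := IH hw.
rewrite /rank -cats1 count_cat /= addn0 exprD -/(rank w).
have := natr_ge2 hb; case: eqVneq => [->|b2] hb' /=.
  by rewrite mulr1; lra.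
have : (3 : R) <= b%:R by rewrite ler_nat ltn_neqAle eq_sym b2.
rewrite expr1; nra.
Qed.

Lemma wden_nseq w n : wden (w ++ nseq n 2%N) =
  ((wden w).1 + n%:R * (wden w).2, (wden w).2).
Proof.
elim: n w => [|n IH] w; first by rewrite cats0 mul0r addr0; case: (wden w).
rewrite -cat_rcons IH wden_rcons /=; congr pair; first by rewrite -natr1; ring.
all: ring.
Qed.

Lemma wden_blk w n b : wden (w ++ blk n b) =
  ((wden w).1 + n.+1%:R * (wden w).2,
   (b%:R - 2) * ((wden w).1 + n%:R * (wden w).2) + (b%:R - 1) * (wden w).2).
Proof.
rewrite /blk -rcons_cat wden_rcons wden_nseq /= -natr1; congr pair; ring.
Qed.

Lemma wratio_blk n b : wratio (blk n b) = ((b%:R - 2) * n%:R + (b%:R - 1)) ^- 2.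
Proof. by rewrite /wratio -[blk n b]cat0s wden_blk /= add0r !mulr1. Qed.

Lemma all_blk n b : all (leq 2) (blk n b) = (2 <= b)%N.
Proof. by rewrite /blk all_rcons all_nseq /= orbT andbT. Qed.

Lemma rank_blk n b : (3 <= b)%N -> rank (blk n b) = 1%N.
Proof.
move=> hb; rewrite /rank /blk -cats1 count_cat count_nseq /= mul0n.
by case: eqP hb => [->|].
Qed.

Lemma rank_cat w u : rank (w ++ u) = (rank w + rank u)%N.
Proof. exact: count_cat. Qed.

Lemma hyp_blk w n b : all (leq 2) w -> (3 <= b)%N -> hyp (w ++ blk n b).
Proof.
move=> hw hb; rewrite /hyp all_cat hw all_blk (ltnW hb) /blk last_cat last_rcons.
by rewrite gtn_eqF.
Qed.

(** In the coordinate 1/x the parabolic branch is the translation by 1. *)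
Lemma wmap_nseq n x : 0 <= x -> wmap (nseq n 2%N) x = x / (1 + n%:R * x).
Proof.
move=> hx; elim: n => [|n IH]; first by rewrite mul0r addr0 divr1.
rewrite /= -/(wmap _ _) IH /bmap -[n.+1%:R]natr1.
have : 0 <= n%:R * x by rewrite mulr_ge0.
move: (n%:R : R) => m hm; field.
by rewrite !gt_eqF //; lra.
Qed.

Lemma wmap_blk n b x : (3 <= b)%N -> 0 <= x ->
  wmap (blk n b) x = (n%:R + (bmap b x)^-1)^-1.
Proof.
move=> hb hx; rewrite /blk wmap_rcons wmap_nseq ?bmap_ge0 // 1?ltnW //.
have := bmap_ge_half hb hx; move: (bmap b x) => y hy.
have : 0 <= n%:R * y by rewrite mulr_ge0 //; lra.
move: (n%:R : R) => m h.
have y0 : y != 0 by rewrite gt_eqF //; lra.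
have my : 1 + m * y != 0 by rewrite gt_eqF //; lra.
have -> : m + y^-1 = (1 + m * y) / y by field.
by rewrite invf_div.
Qed.

(** A digit b >= 3 maps into [1/2, 1), so its image has inverse between 1 and 2, and the preceding
    [n] digits 2 add [n] to this inverse. *)
Lemma wmap_blk_bounds n b x : (3 <= b)%N -> 0 <= x ->
  n.+2%:R^-1 <= wmap (blk n b) x <= n.+1%:R^-1.
Proof.
move=> hb hx; rewrite wmap_blk //.
have h1 := bmap_ge_half hb hx; have h2 := bmap_lt1 (ltnW hb) hx.
move: (bmap b x) h1 h2 => y h1 h2.
have : 1 <= y^-1 by rewrite invf_ge1; lra.
have : y^-1 <= 2 by rewrite -[2]invrK lef_pV2 ?posrE; lra.
have n0 : 0 <= n%:R :> R by [].
rewrite -(addn2 n) -(addn1 n) !natrD => *.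
by rewrite !lef_pV2 ?posrE; lra.
Qed.

(* Digits bounded by M keep the limit set at distance 1/M from 1, which is what
   makes the first-level pieces disjoint. *)
Lemma bmap_sep M a b x y : (2 <= a)%N -> (a < b)%N -> (b <= M)%N ->
  0 <= x <= 1 - M%:R^-1 -> 0 <= y -> M%:R ^- 3 <= bmap b y - bmap a x.
Proof.
move=> ha ab bM /andP[x0 xM] y0.
have := natr_ge2 ha.
have h1 : (a%:R + 1 : R) <= b%:R by rewrite natr1 ler_nat.
have h2 : (b%:R : R) <= M%:R by rewrite ler_nat.
rewrite /bmap; move: (a%:R : R) (b%:R : R) (M%:R : R) h1 h2 xM => A B m h1 h2 xM hA.
have : (B - 1 + y)^-1 <= A^-1 by rewrite lef_pV2 ?posrE; lra.
have mV : 0 < m^-1 <= 1 by rewrite invr_gt0 invf_le1; lra.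
have : (A - m^-1)^-1 <= (A - 1 + x)^-1 by rewrite lef_pV2 ?posrE; lra.
(* Consecutive branches would touch at x = 1, y = 0; the gap [m^-1] left by [x] below 1 is what
   separates the images. *)
suff : m ^- 3 <= (A - m^-1)^-1 - A^-1 by lra.
have -> : (A - m^-1)^-1 - A^-1 = (m * (A * (A - m^-1)))^-1.
  field; rewrite !gt_eqF //; try lra; rewrite subr_gt0; nra.
rewrite lef_pV2 ?posrE ?exprn_gt0 ?mulr_gt0; try lra.
rewrite exprS; apply: ler_wpM2l; first lra.
by rewrite expr2; apply: ler_pM; lra.
Qed.

End BranchMaps.

(** * The limit set *)

Section LimitSet.
Variables (R : realType) (I : set nat).
Hypothesis I_ge2 : I `<=` [set n | (2 <= n)%N].
Implicit Types (b n : nat) (w u : seq nat) (x y z : R) (A : set R).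

Local Notation E := (backward_cf_set R I).

Lemma digits_ge2 w : all (mem I) w -> all (leq 2) w.
Proof. by apply: sub_all => b; rewrite inE => /I_ge2. Qed.

Lemma bcf_tail_ge1 (d : nat -> nat) n : (forall n, I (d n)) -> 1 <= bcf_tail R d n.
Proof.
elim: n d => [|n IH] d hd /=.
  by have := natr_ge2 R (I_ge2 (hd 0%N)); lra.
have h1 := IH _ (fun k => hd k.+1).
have := natr_ge2 R (I_ge2 (hd 0%N)).
have : (bcf_tail R (fun k => d k.+1) n)^-1 <= 1 by rewrite invf_le1; lra.
by lra.
Qed.

Lemma rational_bmap b x : rational x -> rational (bmap b x).
Proof.
case=> q _ <-; exists (1 - (b%:R - 1 + q)^-1) => //.
by rewrite /bmap rmorphB fmorphV rmorphD rmorphB rmorph_nat !rmorph1.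
Qed.

Lemma cf_set_01 z : E z -> 0 < z < 1.
Proof. by case. Qed.

(** Inverting the first branch at [z] gives [y], which is then the limit of the truncations of the
    shifted expansion. Irrationality passes to [y] and keeps it off the endpoints 0 and 1. *)
Lemma cf_set_bmap z : E z -> exists b y, [/\ I b, E y & z = bmap b y].
Proof.
case=> z01 [zirr [d [hd hlim]]].
set y : R := (1 - z)^-1 - ((d 0%N)%:R - 1).
have z1 : 1 - z != 0 by rewrite gt_eqF //; lra.
have zy : z = bmap (d 0%N) y.
  by rewrite /bmap /y addrCA subrr addr0 invrK; ring.
have d2 := natr_ge2 R (I_ge2 (hd 0%N)).
have hcv : 1 - (bcf_tail R (fun k => d k.+1) n)^-1 @[n --> \oo] --> y.
  have h1 : (1 - (1 - (bcf_tail R d n)^-1))^-1 @[n --> \oo] --> (1 - z)^-1.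
    by apply: cvgV => //; apply: cvgB => //; exact: cvg_cst.
  have {h1} h2 : bcf_tail R d n @[n --> \oo] --> (1 - z)^-1.
    apply: cvg_trans h1; apply: near_eq_cvg; near=> n.
    by rewrite /= subKr invrK.
  have h3 : bcf_tail R d n.+1 @[n --> \oo] --> (1 - z)^-1.
    by rewrite (cvg_shiftS (bcf_tail R d)).
  have h4 : bcf_tail R d n.+1 - ((d 0%N)%:R - 1) @[n --> \oo] --> y.
    by apply: cvgB => //; exact: cvg_cst.
  by apply: cvg_trans h4; apply: near_eq_cvg; near=> n => /=; ring.
have yirr : irrational y by move=> /(rational_bmap (d 0%N)); rewrite -zy.
have hbd n : 0 <= 1 - (bcf_tail R (fun k => d k.+1) n)^-1 <= 1.
  have h := bcf_tail_ge1 n (fun k => hd k.+1).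
  have : (bcf_tail R (fun k => d k.+1) n)^-1 <= 1 by rewrite invf_le1; lra.
  have : 0 <= (bcf_tail R (fun k => d k.+1) n)^-1 by rewrite invr_ge0; lra.
  by lra.
have ycvg := cvg_lim (@Rhausdorff R) hcv.
have y0 : 0 <= y.
  by rewrite -ycvg; apply: limr_ge; [apply: cvgP hcv|near=> n; case/andP: (hbd n)].
have y1 : y <= 1.
  by rewrite -ycvg; apply: limr_le; [apply: cvgP hcv|near=> n; case/andP: (hbd n)].
exists (d 0%N), y; split=> //; split; last first.
  by split=> //; exists (fun k => d k.+1); split.
rewrite !lt_neqAle y0 y1 !andbT; apply/andP; split.
  by apply/eqP => h; apply: yirr; exists 0; rewrite // rmorph0.
by apply/eqP => h; apply: yirr; exists 1; rewrite // rmorph1.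
Unshelve. all: by end_near. Qed.

(* Inverting a branch replaces the denominator q of p/q by q - p, so a rational
   orbit inside (0,1) would give an infinite descent. *)
Lemma coind_irrational A :
  (forall x, A x -> 0 < x < 1 /\ exists b y, [/\ I b, A y & x = bmap b y]) ->
  forall x, A x -> irrational x.
Proof.
move=> hA x Ax /rationalP[p [q xpq]].
have [q0 xqp] : (0 < q)%N /\ x * q%:R = p%:~R.
  have [x01 _] := hA _ Ax.
  have q0 : (q%:R : R) != 0.
    by apply/eqP => q0; move: xpq x01; rewrite q0 invr0 mulr0 => ->; lra.
  by rewrite xpq divfK // lt0n -(pnatr_eq0 R).
move=> {xpq}; elim/ltn_ind: q p x Ax q0 xqp => q IH p x Ax q0 xqp.
have [/andP[x0 x1] [b [y [Ib Ay xy]]]] := hA _ Ax; have [y01 _] := hA _ Ay.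
have p0 : 0 < p by rewrite -(ltr0z R) -xqp mulr_gt0 ?ltr0n.
case: p p0 xqp => // m m0 xqm.
have mq : (m < q)%N by rewrite -(ltr_nat R) -[ltLHS]xqm gtr_pMl ?ltr0n.
have b2 := natr_ge2 R (I_ge2 Ib).
have E1 : (1 - x) * (b%:R - 1 + y) = 1.
  by rewrite xy /bmap; field; rewrite gt_eqF //; lra.
(* With x = m / q, the equation x = [bmap b y] reads y = q / (q - m) - (b - 1). *)
apply: (IH (q - m)%N _ (q%:Z - (b%:Z - 1) * (q - m)%:Z) y) => //.
- by rewrite ltn_subrL q0 andbT.
- by rewrite subn_gt0.
rewrite rmorphB rmorphM rmorphB /= natrB ?(ltnW mq) //.
have -> : (m%:R : R) = x * q%:R by rewrite xqm.
have : q%:R * ((1 - x) * (b%:R - 1 + y)) = q%:R * 1 :> R by rewrite E1.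
move: (xqm); rewrite -!pmulrn natrB ?(ltnW mq) // => <- h.
by rewrite -[RHS]subr0 -(subrr (q%:R * 1)) -{2}h; ring.
Qed.

(** Each digit, even 2, raises r + s by at least 1. Hence truncations converge at a rate 1/n
    although runs of the neutral digit do not contract uniformly. *)
Lemma wden_size w : all (leq 2) w ->
  (size w).+1%:R <= (wden R w).1 + (wden R w).2.
Proof.
elim/last_ind: w => [|w b IH]; first by rewrite /wden /= add0r.
rewrite all_rcons size_rcons wden_rcons -[_.+2%:R]natr1 => /andP[hb hw] /=.
by have [h1 h2] := wden_ge R hw; have := natr_ge2 R hb; have := IH hw; nra.
Qed.

(** Evaluating at 1 makes the last branch equal to [1 - b^-1], which is where the finite fraction
    stops. *)
Lemma bcf_tail_wmap (d : nat -> nat) n :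
  1 - (bcf_tail R d n)^-1 = wmap (mkseq d n.+1) 1.
Proof.
elim: n d => [|n IH] d; first by rewrite /= /bmap subrK.
have -> : mkseq d n.+2 = d 0%N :: mkseq (fun k => d k.+1) n.+1.
  by rewrite {1}/mkseq -[n.+2]add1n iotaD map_cat (iotaDl 1 0) -map_comp.
rewrite -cat1s wmap_cat -IH /= /bmap.
by congr (1 - _^-1); ring.
Qed.

(** Coinduction principle for the limit set. Iterating a choice of [(b, y)] produces the digits, the
    growth of r + s makes the truncations converge to [x], and the descent on denominators gives
    irrationality. *)
Lemma cf_set_coind A :
  (forall x, A x -> 0 < x < 1 /\ exists b y, [/\ I b, A y & x = bmap b y]) ->
  A `<=` E.
Proof.
move=> hA x Ax.
have [f hf] : {f : R -> nat * R & forall x, A x ->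
    [/\ I (f x).1, A (f x).2 & x = bmap (f x).1 (f x).2]}.
  apply: (@choice _ _ (fun x p => A x -> [/\ I p.1, A p.2 & x = bmap p.1 p.2])).
  move=> y; have [/hA[_ [b [z h]]]|nAy] := pselect (A y); first by exists (b, z).
  by exists (0%N, 0).
pose zs k := iter k (fun y => (f y).2) x.
pose d k := (f (zs k)).1.
have Azs k : A (zs k) by elim: k => //= k /hf[].
have hd k : I (d k) by have [] := hf _ (Azs k).
have zsS k : zs k = bmap (d k) (zs k.+1) by have [] := hf _ (Azs k).
have [x01 _] := hA _ Ax; split=> //; split; first exact: coind_irrational hA _ Ax.
exists d; split=> //.
have zsE n : zs 0%N = wmap (mkseq d n) (zs n).
  elim: n => // n IH; rewrite {1}IH zsS /mkseq -[n.+1]addn1 iotaD map_cat wmap_cat.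
  by rewrite addn1.
have dge2 n : all (leq 2) (mkseq d n).
  by apply/allP => _ /mapP[k _ ->]; exact: I_ge2.
have bd n : `|x - (1 - (bcf_tail R d n)^-1)| <= n.+1%:R^-1.
  have [z01 _] := hA _ (Azs n.+1).
  rewrite -[x]/(zs 0%N) (zsE n.+1) bcf_tail_wmap wmap_sub //; try lra.
  have [h1 h2] := wden_ge R (dge2 n.+1).
  have := wden_size (dge2 n.+1); rewrite size_mkseq mulr1.
  have rz : 0 <= (wden R (mkseq d n.+1)).1 * zs n.+1 by apply: mulr_ge0; lra.
  set s := (wden R _).2; set r := (wden R _).1 => hs.
  have n0 : (0 : R) < n.+1%:R by [].
  have n2 : (n.+1%:R : R) <= n.+2%:R by rewrite ler_nat.
  have P : n.+1%:R <= (s + r * zs n.+1) * (s + r).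
    rewrite -[leLHS]mul1r; apply: ler_pM => //; rewrite -/s -/r in h2 rz; lra.
  have D0 := lt_le_trans n0 P.
  rewrite ?mulr1 normrM normfV (gtr0_norm D0).
  apply: (@le_trans _ _ (((s + r * zs n.+1) * (s + r))^-1)).
    by rewrite ler_piMl ?invr_ge0 ?(ltW D0) // ler_norml; lra.
  by rewrite lef_pV2 ?posrE.
apply/cvgrPdist_le => e e0; near=> n.
apply: le_trans (bd n) _.
apply/ltW; near: n; exact: (near_infty_natSinv_lt (PosNum e0)).
Unshelve. all: by end_near. Qed.

End LimitSet.

(** * Words and blocks acting on the limit set *)

Section Words.
Variables (R : realType) (I : set nat).
Hypothesis I_ge2 : I `<=` [set n | (2 <= n)%N].
Implicit Types (b n : nat) (w u : seq nat) (x y z : R) (A : set R).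

Local Notation E := (backward_cf_set R I).
Local Notation digits_ge2 := (digits_ge2 I_ge2).

Lemma wmap_gt0 w x : all (leq 2) w -> 0 < x -> 0 < wmap w x.
Proof.
elim: w => //= b w IH /andP[/(natr_ge2 R) hb hw] hx.
have := IH hw hx; rewrite -/(wmap w x) /bmap; move: (wmap w x) => y hy.
by rewrite subr_gt0 invf_lt1; lra.
Qed.

Lemma wmap_lt1 w x : all (leq 2) w -> 0 <= x < 1 -> wmap w x < 1.
Proof.
case: w => [|b w] /=; first by move=> _; lra.
by move=> /andP[hb hw] hx; rewrite bmap_lt1 // wmap_ge0 //; lra.
Qed.

Lemma wmap_rank_gt0 w x : all (leq 2) w -> (0 < rank w)%N -> 0 <= x ->
  0 < wmap w x.
Proof.
elim: w => //= b w IH /andP[hb hw]; rewrite /rank /= => hr hx.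
have y0 : 0 <= wmap w x by exact: wmap_ge0.
rewrite -/(wmap w x).
move: hr; case: (eqVneq b 2%N) => [b2|b2] /= hr.
  have {}y0 := IH hw hr hx.
  by rewrite b2 /bmap subr_gt0 invf_lt1; lra.
have b3 : (3 <= b)%N by rewrite ltn_neqAle eq_sym b2.
by have := bmap_ge_half b3 y0; lra.
Qed.

(** The images of [A] under nonempty words form a set [B] that contains [A] and from which digits
    can be stripped one at a time. *)
Lemma cf_set_coind_words A :
  (forall x, A x -> 0 < x < 1 /\ exists w y,
     [/\ w != [::], all (mem I) w, A y & x = wmap w y]) -> A `<=` E.
Proof.
move=> hA x Ax.
pose B : set R := [set z | exists w y,
  [/\ w != [::], all (mem I) w, A y & z = wmap w y]].
apply: (@cf_set_coind _ _ I_ge2 B); last by have [] := hA _ Ax.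
move=> _ [[|b w] [y [// _ /[dup] hbw /andP[hb hw] Ay ->]]].
have [y01 By] := hA _ Ay; split.
  by rewrite wmap_gt0 ?wmap_lt1 ?digits_ge2 //; lra.
exists b, (wmap w y); split=> //; first exact: set_mem.
by case: w hw {hbw} => [//|b' w] hw; exists (b' :: w), y.
Qed.

Lemma cf_set_wmap w y : all (mem I) w -> E y -> E (wmap w y).
Proof.
case: w => [//|b w] hw Ey.
pose A : set R := [set z | E z \/ z = wmap (b :: w) y].
apply: (@cf_set_coind_words A); last by right.
move=> z [Ez|->].
  split; first exact: cf_set_01 Ez.
  have [c [v [Ic Ev ->]]] := cf_set_bmap I_ge2 Ez.
  by exists [:: c], v; split=> //=; [rewrite andbT; exact: mem_set|left].
have y01 := cf_set_01 Ey.
split; first by rewrite wmap_gt0 ?wmap_lt1 ?digits_ge2 //; lra.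
by exists (b :: w), y; split => //; left.
Qed.

(** Stripping a digit 2 lowers 1/z by exactly 1 while 1/z stays positive, so the initial run of 2s
    is finite; the induction is on a bound for 1/z. *)
Lemma cf_set_blk z : E z -> exists n b y,
  [/\ I b, (3 <= b)%N, E y & z = wmap (blk n b) y].
Proof.
move=> Ez.
have [N] : exists N : nat, z^-1 <= N%:R.
  by exists (Num.truncn z^-1).+1; apply/ltW; exact: truncnS_gt.
elim: N z Ez => [|N IH] z Ez hN.
  have := cf_set_01 Ez => z01; have : 0 < z^-1 by rewrite invr_gt0; lra.
  by move=> h; move: (lt_le_trans h hN); rewrite ltxx.
have [b [y [Ib Ey zy]]] := cf_set_bmap I_ge2 Ez.
have [b2|b2] := eqVneq b 2%N; last first.
  exists 0%N, b, y; split=> //.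
  by rewrite ltn_neqAle eq_sym b2; exact: I_ge2.
have y01 := cf_set_01 Ey.
have zy' : z^-1 = y^-1 + 1.
  by rewrite zy b2 /bmap; field; rewrite !gt_eqF //; lra.
have [|n [c [v [Ic c3 Ev yv]]]] := IH y Ey.
  by move: hN; rewrite zy' -natr1; lra.
by exists n.+1, c, v; split=> //; rewrite zy b2 yv.
Qed.

(** [zs k] is the increasing limit of the compositions of [ws k], [ws k.+1], and so on, applied to
    0. Positive rank prevents the limit from being the neutral fixed point 0. *)
Lemma cf_set_lim_words (ws : nat -> seq nat) :
  (forall k, all (mem I) (ws k)) -> (forall k, (0 < rank (ws k))%N) ->
  exists zs : nat -> R, forall k, E (zs k) /\ zs k = wmap (ws k) (zs k.+1).
Proof.
move=> hws hr.
have hws2 k : all (leq 2) (ws k) by exact: digits_ge2.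
have [u [u0 uS]] : exists u : nat -> nat -> R,
    (forall k, u k 0%N = 0) /\ (forall k n, u k n.+1 = wmap (ws k) (u k.+1 n)).
  by exists (fix u (k n : nat) {struct n} : R :=
    if n is m.+1 then wmap (ws k) (u k.+1 m) else 0).
have u01 k n : 0 <= u k n < 1.
  elim: n k => [|n IH] k; first by rewrite u0; lra.
  by have /andP[h1 h2] := IH k.+1; rewrite uS wmap_ge0 ?wmap_lt1 ?h1.
have umon k n : u k n <= u k n.+1.
  elim: n k => [|n IH] k; first by rewrite u0; case/andP: (u01 k 1%N).
  have /andP[h0 _] := u01 k.+1 n.
  by rewrite uS [leRHS]uS; apply: wmap_homo.
have ucv k : cvgn (u k).
  apply: nondecreasing_is_cvgn; first exact/nondecreasing_seqP.
  by exists 1 => _ [n _ <-]; case/andP: (u01 k n) => _ /ltW.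
pose zs k := limn (u k).
have zs0 k : 0 <= zs k.
  by apply: limr_ge (ucv k) _; near=> n; case/andP: (u01 k n).
have zsS k : zs k = wmap (ws k) (zs k.+1).
  apply: (cvg_lim (@Rhausdorff R)).
  rewrite -(cvg_shiftS (u k)); apply/cvgrPdist_le => e e0.
  have /cvgrPdist_le /(_ e e0) h := ucv k.+1.
  near=> n; rewrite /= uS.
  apply: le_trans (wmap_lip _ _ _) _ => //; first by case/andP: (u01 k.+1 n).
  apply: (@le_trans _ _ `|zs k.+1 - u k.+1 n|); last by near: n.
  rewrite ler_piMl // (le_trans (wratio_rank _ _)) // exprn_ile1 //; lra.
have zs1 k : zs k < 1.
  have h1 : zs k.+1 <= 1.
    by apply: limr_le (ucv k.+1) _; near=> n; case/andP: (u01 k.+1 n) => _ /ltW.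
  rewrite zsS; case: (ws k) (hr k) (hws2 k) => [//|b w] _ /= /andP[hb hw].
  by rewrite bmap_lt1 // wmap_ge0.
have zsp k : 0 < zs k by rewrite zsS wmap_rank_gt0.
exists zs => k; split=> //.
apply: (@cf_set_coind_words (range zs)); last by exists k.
move=> _ [j _ <-]; split; first by rewrite zsp zs1.
exists (ws j), (zs j.+1); split; [|exact: hws|by exists j.+1|exact: zsS].
by apply/eqP => ws0; move: (hr j); rewrite ws0.
Unshelve. all: by end_near. Qed.

End Words.

(** * Hausdorff dimension from below *)

Section Separation.
Variables (R : realType) (I : set nat) (M : nat).
Hypothesis I_ge2 : I `<=` [set n | (2 <= n)%N].
Hypothesis I_leM : I `<=` [set n | (n <= M)%N].
Implicit Types (b n : nat) (w u : seq nat) (x y z : R).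

Local Notation E := (backward_cf_set R I).
Local Notation digits_ge2 := (digits_ge2 I_ge2).

(* The forward-invariant interval that contains the limit set. *)
Definition core : set R := [set x | 0 <= x <= 1 - M%:R^-1].

Lemma core_le1 x : core x -> 0 <= x <= 1.
Proof. by rewrite /core /= => ?; have : 0 <= M%:R^-1 :> R by []; lra. Qed.

Lemma core_bmap b x : I b -> 0 <= x <= 1 -> core (bmap b x).
Proof.
move=> Ib x01; have b2 := I_ge2 Ib; rewrite /core /= bmap_ge0 //=; last lra.
apply: le_trans (bmap_le b2 x01) _; rewrite lerD2l lerN2 lef_pV2 ?posrE ?ltr0n.
- by rewrite ler_nat; exact: I_leM.
- exact: leq_trans (ltnW b2) (I_leM Ib).
- exact: ltnW b2.
Qed.

Lemma core_wmap w x : all (mem I) w -> core x -> core (wmap w x).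
Proof.
elim: w => //= b w IH /andP[/set_mem Ib hw] cx.
by apply: core_bmap => //; apply: core_le1; exact: IH.
Qed.

Lemma cf_set_core : E `<=` core.
Proof.
move=> x /(cf_set_bmap I_ge2)[b [y [Ib Ey ->]]].
by apply: core_bmap => //; have := cf_set_01 Ey; lra.
Qed.

(** A common digit shrinks distances by a factor no smaller than [M%:R ^- 2], and at the first
    differing digit the images are [M%:R ^- 3] apart. The prefix conditions guarantee that such a
    digit exists. *)
Lemma words_sep w w' x y : all (mem I) w -> all (mem I) w' ->
  ~~ prefix w w' -> ~~ prefix w' w -> core x -> core y ->
  M%:R ^- 3 * (M%:R ^- 2) ^+ size w <= `|wmap w x - wmap w' y|.
Proof.
elim: w w' => [|a w IH] [|b w'] //= /andP[/set_mem Ia hw] /andP[/set_mem Ib hw'].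
rewrite /= eq_sym; have cx' := @core_wmap w _ hw; have cy' := @core_wmap w' _ hw'.
have M1 : (1 : R) <= M%:R by rewrite (ler_nat _ 1) (leq_trans _ (I_leM Ia)) // ltnW // I_ge2.
have M0 : (M%:R : R) ^- 2 <= 1.
  by rewrite invf_le1 ?exprn_gt0 ?exprn_ege1 //; lra.
have M20 : 0 <= (M%:R : R) ^- 2 by rewrite invr_ge0 exprn_ge0 //; lra.
have M30 : 0 <= (M%:R : R) ^- 3 by rewrite invr_ge0 exprn_ge0 //; lra.
have [<-{b Ib}|ab] /= := eqVneq a b.
  move=> pw pw' cx cy.
  have {}IH := IH _ hw hw' pw pw' cx cy.
  have {cx'}cx := core_le1 (cx' _ cx); have {cy'}cy := core_le1 (cy' _ cy).
  rewrite -/(wmap w x) -/(wmap w' y) bmap_sub; try lra; last exact: I_ge2.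
  have a2 := natr_ge2 R (I_ge2 Ia).
  have aM : (a%:R : R) <= M%:R by rewrite ler_nat; exact: I_leM.
  move: (wmap w x) (wmap w' y) cx cy IH => X Y cx cy IH.
  rewrite normrM normfV [_ ^+ (size w).+1]exprS mulrA mulrAC.
  apply: ler_pM => //.
  have aX : 0 < a%:R - 1 + X by lra.
  have aY : 0 < a%:R - 1 + Y by lra.
  rewrite lef_pV2 ?posrE ?normr_gt0 ?mulf_neq0 ?exprn_gt0 ?gt_eqF //; last lra.
  by rewrite (ger0_norm (ltW (mulr_gt0 aX aY))) expr2; apply: ler_pM; lra.
move=> _ _ cx cy; have {}cx := cx' _ cx; have {}cy := cy' _ cy.
rewrite -/(wmap w x) -/(wmap w' y).
apply: (@le_trans _ _ (M%:R ^- 3)).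
  by rewrite ler_piMr // exprn_ile1 // ?mulr_ge0 ?exprn_ge0.
have [ltab|ltba|eqab] := ltngtP a b; last by rewrite eqab eqxx in ab.
- rewrite distrC; apply: le_trans (ler_norm _).
  apply: bmap_sep => //; [exact: I_ge2|exact: I_leM|by case/andP: cy].
- apply: le_trans (ler_norm _).
  apply: bmap_sep => //; [exact: I_ge2|exact: I_leM|by case/andP: cx].
Qed.

(** A proper extension ending at a digit other than 2 has larger rank. Distinct words with equally
    many blocks are therefore incomparable, as [words_sep] requires. *)
Lemma prefix_hyp_rank w w' : hyp w' -> rank w = rank w' -> prefix w w' -> w = w'.
Proof.
move=> hw' hr /prefixP[v E']; case/lastP: v E' => [|v b] E'; first by rewrite cats0 in E'.
move: hw' hr; rewrite E' /hyp last_cat last_rcons rank_cat => /andP[_ b2] /eqP.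
rewrite -{1}[rank w]addn0 eqn_add2l /rank -cats1 count_cat /= b2.
by rewrite addn1.
Qed.

End Separation.

(** * Mass distribution on a tree of words *)

Section TreeCover.
Variables (R : realType) (I : set nat) (M : nat).
Hypothesis I_ge2 : I `<=` [set n | (2 <= n)%N].
Hypothesis I_leM : I `<=` [set n | (n <= M)%N].
Implicit Types (b n : nat) (w u p : seq nat) (x y z : R).

Local Notation E := (backward_cf_set R I).
Local Notation core := (@core R M).
Local Notation digits_ge2 := (digits_ge2 I_ge2).

Lemma uniform_words_sep (W : seq (seq nat)) (m : nat) : (0 < M)%N ->
  (forall w, w \in W -> [/\ all (mem I) w, hyp w & rank w = m]) ->
  exists2 eta : R, 0 < eta & forall w w' x y, w \in W -> w' \in W -> w != w' ->
    core x -> core y -> eta <= `|wmap w x - wmap w' y|.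
Proof.
move=> M0 hW; have M0' : (1 : R) <= M%:R by rewrite (ler_nat _ 1).
exists (M%:R ^- 3 * (M%:R ^- 2) ^+ \max_(w <- W) size w).
  by rewrite mulr_gt0 ?invr_gt0 ?exprn_gt0 ?invr_gt0 ?exprn_gt0 //; lra.
move=> w w' x y wW wW' ww' cx cy.
have [hw1 hw2 hw3] := hW _ wW; have [hw1' hw2' hw3'] := hW _ wW'.
have p1 : ~~ prefix w w'.
  by apply: contra ww' => /prefix_hyp_rank ->; rewrite ?hw3.
have p2 : ~~ prefix w' w.
  by rewrite eq_sym in ww'; apply: contra ww' => /prefix_hyp_rank ->; rewrite ?hw3.
apply: le_trans (words_sep I_ge2 I_leM hw1 hw1' p1 p2 cx cy).
rewrite ler_wpM2l // ler_wiXn2l ?invf_le1 ?exprn_gt0 ?exprn_ege1 //; last 2 first.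
- by lra.
- exact: leq_bigmax_seq.
Qed.

(* Descend the tree of words in W, choosing at each step a child whose piece is
   met by cover elements of total weight less than (eta * contraction)^t; the
   limit point would lie in a set of diameter zero. *)
Lemma tree_cover (W : seq (seq nat)) (m : nat) (t : R) : 0 < t -> uniq W ->
  (forall w, w \in W -> [/\ all (mem I) w, hyp w & rank w = m.+1]) ->
  1 <= \sum_(w <- W) (wratio R w / 4) `^ t ->
  exists2 eta : R, 0 < eta & forall (U : nat -> set R) (d : nat -> R),
    (forall i x y, U i x -> U i y -> `|x - y| <= d i) -> (forall i, 0 < d i) ->
    E `<=` \bigcup_i U i ->
    ((eta `^ t)%:E <= \sum_(0 <= i <oo) (d i `^ t)%:E)%E.
Proof.
move=> t0 uW hW sumW.
have M0 : (0 < M)%N.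
  case: W {uW} hW sumW => [|w W] hW; first by rewrite big_nil; lra.
  have [+ _] := hW w (mem_head _ _); rewrite /rank; case: w {hW} => //= b w.
  by case/andP=> /set_mem Ib _ _ _; apply: leq_trans (I_leM Ib); rewrite ltnW ?I_ge2.
have [eta eta0 hsep] := uniform_words_sep M0 hW.
exists eta => // U d hU d0 EU; rewrite leNgt; apply/negP => sumd.
pose meets p i := `[< exists2 y, core y & U i (wmap p y) >].
pose f p i : \bar R := (if meets p i then d i `^ t else 0)%:E.
pose V p : \bar R := (\sum_(0 <= i <oo) f p i)%E.
have f0 p i : (0 <= f p i)%E by rewrite /f; case: ifP; rewrite lee_fin ?powR_ge0.
(* State of the descent: a word and a lower bound for its contraction on [core], such that the cover
   elements meeting its piece weigh too little. *)
pose good (s : seq nat * R) := [/\ all (mem I) s.1, 0 < s.2,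
  forall x y, core x -> core y -> s.2 * `|x - y| <= `|wmap s.1 x - wmap s.1 y| &
  (V s.1 < ((eta * s.2) `^ t)%:E)%E].
have term p i : meets p i -> ((d i `^ t)%:E <= V p)%E.
  move=> hm; apply: le_trans (nneseries_lim_ge i.+1 _) => //.
  rewrite big_nat_recr //= {2}/f hm; apply: leeDr; exact: sume_ge0.
have c0 w : w \in W -> 0 < wratio R w / 4.
  by case/hW => hw _ _; rewrite divr_gt0 // wratio_gt0 // digits_ge2.
have step s : good s -> exists w, w \in W /\ good (s.1 ++ w, s.2 * (wratio R w / 4)).
  case: s => p C [/= hp C0 hC hV].
  apply: contrapT => hno.
  have hge w : w \in W -> (((eta * C) `^ t)%:E * ((wratio R w / 4) `^ t)%:E <= V (p ++ w))%E.
    move=> wW; rewrite leNgt; apply/negP => hlt; apply: hno; exists w; split=> //.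
    have [hw hyw rw] := hW _ wW; have cw := c0 _ wW.
    split=> /=; [by rewrite all_cat hp|by rewrite mulr_gt0| |].
    - move=> x y cx cy; rewrite !wmap_cat.
      apply: le_trans (hC _ _ (core_wmap I_ge2 I_leM hw cx) (core_wmap I_ge2 I_leM hw cy)).
      rewrite -mulrA (ler_wpM2l (ltW C0)) //.
      by apply: wmap_colip => //; exact: (@core_le1 R M).
    - by rewrite mulrA powRM ?(ltW cw) ?mulr_ge0 ?ltW.
  suff : (((eta * C) `^ t)%:E <= V p)%E by rewrite leNgt hV.
  apply: (@le_trans _ _ (\sum_(w <- W) V (p ++ w))%E).
    apply: (@le_trans _ _ (\sum_(w <- W) ((eta * C) `^ t)%:E * ((wratio R w / 4) `^ t)%:E)%E).
      rewrite -ge0_sume_distrr; last by move=> w _; rewrite lee_fin powR_ge0.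
      by rewrite sumEFin -EFinM lee_fin ler_peMr ?powR_ge0.
    by rewrite big_seq [leRHS]big_seq; apply: lee_sum => w /hge.
  rewrite /V -nneseries_sum //; apply: lee_nneseries => [i _ _|i _].
    by apply: sume_ge0 => w _; exact: f0.
  (* Each [U i] meets at most one child: two children lie [eta * C] apart, and a set that large
     would alone outweigh the bound on [V p]. *)
  have [[w wW hm]|hn] := pselect (exists2 w, w \in W & meets (p ++ w) i); last first.
    rewrite big_seq big1 // => w wW; rewrite /f ifF //.
    by apply/negP => hm; apply: hn; exists w.
  have hmp : meets p i.
    move: hm => /asboolP[y cy Uy]; apply/asboolP; exists (wmap w y); last by rewrite -wmap_cat.
    by have [hw _ _] := hW _ wW; exact: (core_wmap I_ge2 I_leM hw cy).
  rewrite (bigD1_seq w) //= big_seq_cond big1 ?adde0; first by rewrite /f hm hmp.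
  move=> w' /andP[wW' ww']; rewrite /f ifF //; apply/negP => hm'.
  move: hm hm' => /asboolP[y cy Uy] /asboolP[y' cy' Uy'].
  have h1 := hU _ _ _ Uy Uy'; rewrite !wmap_cat in h1.
  have [hw _ _] := hW _ wW; have [hw' _ _] := hW _ wW'.
  have h2 := hC _ _ (core_wmap I_ge2 I_leM hw cy) (core_wmap I_ge2 I_leM hw' cy').
  have h3 : eta <= `|wmap w y - wmap w' y'| by apply: hsep => //; rewrite eq_sym.
  have h4 : eta * C <= d i.
    by apply: le_trans h1; apply: le_trans h2; rewrite mulrC ler_wpM2l // ltW.
  have := le_lt_trans (term _ _ hmp) hV; rewrite lte_fin ltNge => /negP; apply.
  by rewrite (ge0_ler_powR (ltW t0)) ?nnegrE ?mulr_ge0 ?(ltW eta0) ?(ltW C0) ?(ltW (d0 _)).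
have [g hg] : {g : seq nat * R -> seq nat & forall s, good s ->
    g s \in W /\ good (s.1 ++ g s, s.2 * (wratio R (g s) / 4))}.
  apply: (@choice _ _ (fun s w => good s -> w \in W /\ good (s.1 ++ w, s.2 * (wratio R w / 4)))).
  move=> s; have [/step[w hw]|ns] := pselect (good s); first by exists w.
  by exists [::].
pose st k := iter k (fun s => (s.1 ++ g s, s.2 * (wratio R (g s) / 4))) ([::], 1).
have gst k : good (st k).
  elim: k => [|k IH]; last by case: (hg _ IH).
  split=> //=; first by move=> x y _ _; rewrite mul1r.
  rewrite mulr1; apply: le_lt_trans sumd; apply: lee_nneseries => [//|i _].
  by rewrite /f; case: ifP; rewrite lee_fin ?powR_ge0.
pose ws k := g (st k).
have hws k : ws k \in W by case: (hg _ (gst k)).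
have [|k|zs hzs] := @cf_set_lim_words R I I_ge2 ws.
- by move=> k; case: (hW _ (hws k)).
- by have [_ _ ->] := hW _ (hws k).
have zsE k : zs 0%N = wmap (st k).1 (zs k).
  elim: k => [//|k IH]; rewrite {1}IH /= wmap_cat -/(ws k).
  by have [_ <-] := hzs k.
have [Ez _] := hzs 0%N; have [j _ Uj] := EU _ Ez.
(* The limit point lies in every piece of the branch, so the set [U j] containing it is charged at
   each level; this bounds [d j] by arbitrarily small numbers. *)
have dj k : d j < eta * 2 ^- k.
  have [_ C0 _ hV] := gst k.
  have hm : meets (st k).1 j.
    apply/asboolP; exists (zs k); last by rewrite -zsE.
    by apply: (cf_set_core I_ge2 I_leM); case: (hzs k).
  have := le_lt_trans (term _ _ hm) hV; rewrite lte_fin => h.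
  apply: (@lt_le_trans _ _ (eta * (st k).2)).
    rewrite ltNge; apply/negP => h'; move: h; rewrite ltNge => /negP; apply.
    by rewrite (ge0_ler_powR (ltW t0)) ?nnegrE ?mulr_ge0 ?(ltW eta0) ?(ltW C0) ?(ltW (d0 _)).
  rewrite (ler_wpM2l (ltW eta0)) {hm hV h}//.
  elim: k C0 => [|k IH] C0; first by rewrite /= expr0 invr1.
  have [_ C0' _ _] := gst k; have {}IH := IH C0'.
  have r1 : wratio R (ws k) <= 1.
    have [hw _ _] := hW _ (hws k).
    by rewrite (le_trans (wratio_rank _ (digits_ge2 hw))) // exprn_ile1 //; lra.
  have r0 := c0 _ (hws k).
  rewrite /= -/(ws k) exprS invfM [leRHS]mulrC; apply: ler_pM => //; [exact: ltW|exact: ltW|lra].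
have e0 : 0 < d j / eta by rewrite divr_gt0.
have [k _ /(_ k (leqnn k)) /=] := near_infty_natSinv_expn_lt (PosNum e0).
rewrite div1r ltr_pdivlMr // mulrC => h.
by have := lt_trans (dj k) h; rewrite ltxx.
Qed.

End TreeCover.

(** * Coverings by balls *)

Section Coverings.
Variable R : realType.
Implicit Types (A B : set R) (l : seq R) (r x y : R).

Definition covers r l A := forall x, A x -> exists2 y, y \in l & `|x - y| < r.

(** The bound is real and need not be attained, so that estimates can be summed and weakened without
    rounding. *)
Definition coverable r A (N : R) := exists2 l, covers r l A & (size l)%:R <= N.

Lemma covering_number_le r A N : coverable r A N -> (covering_number r A <= N%:E)%E.
Proof.
case=> l hl hN; apply: (@le_trans _ _ (size l)%:R%:E); last by rewrite lee_fin.
apply: ereal_inf_lbound; exists (size l) => //=; exists (fun i => nth 0 l i).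
move=> x /hl[y yl xy]; have il : (index y l < size l)%N by rewrite index_mem.
by exists (Ordinal il) => //=; rewrite nth_index // /ball /= distrC.
Qed.

Lemma covering_number_ge r A N :
  (forall l, covers r l A -> N <= (size l)%:R) -> (N%:E <= covering_number r A)%E.
Proof.
move=> h; apply: le_ereal_inf_tmp => _ [n [c Ac] <-]; rewrite lee_fin.
rewrite -[n]card_ord cardE -(size_map c); apply: h => x /Ac[i _ cix].
by exists (c i); [apply: map_f; rewrite mem_enum|rewrite distrC].
Qed.

Lemma cov_subset r A B N : A `<=` B -> coverable r B N -> coverable r A N.
Proof. by move=> AB [l hl hN]; exists l => // x /AB /hl. Qed.

Lemma cov_le r A N N' : N <= N' -> coverable r A N -> coverable r A N'.
Proof. by move=> NN' [l hl hN]; exists l => //; exact: le_trans NN'. Qed.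

Lemma cov_interval r A a L : 0 < r -> 0 <= L ->
  (forall x, A x -> a <= x <= a + L) -> coverable r A (L / r + 1).
Proof.
move=> r0 L0 hA; have Lr : 0 <= L / r by rewrite divr_ge0 // ltW.
exists [seq a + j%:R * r | j <- iota 0 (Num.truncn (L / r)).+1]; last first.
  by rewrite size_map size_iota -natr1 lerD2r; case/andP: (truncn_itv Lr).
move=> x /hA /andP[ax xL].
have xr : 0 <= (x - a) / r by rewrite divr_ge0 ?subr_ge0 // ltW.
have /andP[h1 h2] := truncn_itv xr.
exists (a + (Num.truncn ((x - a) / r))%:R * r).
  apply/mapP; exists (Num.truncn ((x - a) / r)) => //.
  rewrite mem_iota /= add0n ltnS; apply: le_truncn.
  by rewrite ler_pM2r ?invr_gt0 //; lra.
move: h1 h2; rewrite -natr1 ler_pdivlMr // ltr_pdivrMr // => h1 h2.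
by rewrite ger0_norm; lra.
Qed.

Lemma cov_bigcup (T : eqType) (s : seq T) (P : T -> set R) (N : T -> R) r A :
  (forall i, i \in s -> coverable r (P i) (N i)) ->
  (forall x, A x -> exists2 i, i \in s & P i x) ->
  coverable r A (\sum_(i <- s) N i).
Proof.
elim: s A => [|i s IH] A hs hA.
  by rewrite big_nil; exists [::] => // x /hA[].
have [l1 h1 h1'] := hs _ (mem_head _ _).
have [|x [Ax nP]|l2 h2 h2'] := IH (A `\` P i).
- by move=> j js; apply: hs; rewrite inE js orbT.
- have [j] := hA _ Ax; rewrite inE => /predU1P[-> //|js Pj]; by exists j.
exists (l1 ++ l2); last by rewrite big_cons size_cat natrD lerD.
move=> x Ax; have [Px|nPx] := pselect (P i x).
  by have [y yl xy] := h1 _ Px; exists y => //; rewrite mem_cat yl.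
by have [y yl xy] := h2 x (conj Ax nPx); exists y => //; rewrite mem_cat yl orbT.
Qed.

Lemma cov_wmap w r A N : all (leq 2) w -> (forall x, A x -> 0 <= x) ->
  coverable r A N -> coverable (wratio R w * r) (wmap w @` A) N.
Proof.
(* Centres may be negative, where [wmap w] is not controlled; moving them to 0 brings them no
   farther from points of [A]. *)
move=> hw A0 [l hl hN]; exists [seq wmap w (Num.max 0 y) | y <- l]; last by rewrite size_map.
move=> _ [x Ax <-]; have [y yl xy] := hl _ Ax; have x0 := A0 _ Ax.
exists (wmap w (Num.max 0 y)); first exact: map_f.
have m0 : 0 <= Num.max 0 y by rewrite le_max lexx.
apply: le_lt_trans (wmap_lip hw x0 m0) _; rewrite (ltr_pM2l (wratio_gt0 R hw)).
by apply: le_lt_trans xy; case: (leP 0 y) => // y0; rewrite subr0 !ger0_norm; lra.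
Qed.

Lemma diam_ge0 A : A !=set0 -> (0 <= diam A)%E.
Proof. by case=> x Ax; apply: ereal_sup_ubound; exists x => //; exists x; rewrite // subrr normr0. Qed.

Lemma diam_pow_ge0 (s : R) A : (0 <= diam_pow s A)%E.
Proof. by rewrite /diam_pow; case: ifP => // _; exact: poweR_ge0. Qed.

Lemma diam_le_dist A x y : A x -> A y -> (`|x - y|%:E <= diam A)%E.
Proof. by move=> Ax Ay; apply: ereal_sup_ubound; exists x => //; exists y. Qed.

Lemma hausdorff_premeasure_ge0 (s delta : R) A : (0 <= hausdorff_premeasure s delta A)%E.
Proof.
by apply: le_ereal_inf_tmp => _ [U _ <-]; apply: nneseries_ge0 => i _ _; exact: diam_pow_ge0.
Qed.

Lemma diam_ball_le x r : 0 < r -> (diam (ball x r) <= (2 * r)%:E)%E.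
Proof.
move=> r0; apply: ge_ereal_sup => _ [y /= hy [z hz <-]]; rewrite lee_fin.
move: hy hz; rewrite /ball /= !ltr_norml => hy hz; rewrite ler_norml; lra.
Qed.

Lemma hausdorff_premeasure_covers (s delta : R) r l A : 0 <= s -> 0 < r -> 2 * r <= delta ->
  covers r l A ->
  (hausdorff_premeasure s delta A <= ((size l)%:R * (2 * r) `^ s)%:E)%E.
Proof.
move=> s0 r0 rd hl.
pose U i := if (i < size l)%N then ball (nth 0 l i) r else set0.
apply: (@le_trans _ _ (\sum_(0 <= i <oo) diam_pow s (U i))%E).
  apply: ereal_inf_lbound; exists U => //; split=> [i|x /hl[y yl xy]].
    rewrite /U; case: ifP => _.
      by apply: le_trans (diam_ball_le _ r0) _; rewrite lee_fin.
    by apply: ge_ereal_sup => z [x []].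
  exists (index y l) => //; rewrite /U index_mem yl nth_index //.
  by rewrite /ball /= distrC.
rewrite (nneseries_split 0 (size l)); last by move=> k _; exact: diam_pow_ge0.
rewrite [X in (_ + X)%E]eseries0 ?adde0; last first.
  move=> i; rewrite add0n => hi _; rewrite /U ltnNge hi /= /diam_pow eqxx //.
rewrite add0n; apply: (@le_trans _ _ (\sum_(0 <= i < size l) ((2 * r) `^ s)%:E)%E).
  rewrite big_nat [leRHS]big_nat; apply: lee_sum => i /andP[_ hi].
  rewrite /U hi /diam_pow; case: ifP => [_|_]; first by rewrite lee_fin powR_ge0.
  have := diam_ball_le (nth 0%R l i) r0.
  have : (0 <= diam (ball (nth 0%R l i) r))%E.
    by apply: diam_ge0; exists (nth 0%R l i); exact: ballxx.
  case: (diam _) => [d||//]; rewrite ?leye_eq // !lee_fin => d0 d2.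
  by rewrite ge0_ler_powR ?nnegrE //; lra.
by rewrite sumEFin sumr_const_nat subn0 -[X in (X%:E <= _)%E]mulr_natl.
Qed.

(** Below the dimension some premeasure at a scale [delta] is positive, and a cover by balls of
    diameter at most [delta] is tested against it. For larger balls it is enough that a cover of a
    nonempty set is nonempty. *)
Lemma covers_lower_bound (s : R) A : A !=set0 -> 0 <= s -> (s%:E < hausdorff_dim A)%E ->
  exists2 c : R, 0 < c <= 1 &
    forall r l, 0 < r -> covers r l A -> c * r `^ (- s) <= (size l)%:R.
Proof.
move=> A0 s0 sd.
have H0 : hausdorff_measure s A <> 0.
  move=> H0; move: sd; rewrite ltNge => /negP; apply.
  by apply: ereal_inf_lbound; exists s.
have [delta d0 hd] : exists2 delta : R, 0 < delta & (0 < hausdorff_premeasure s delta A)%E.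
  apply: contrapT => h; apply: H0; apply/eqP; rewrite eq_le; apply/andP; split.
    apply: ge_ereal_sup => _ [delta /= d0 <-]; rewrite leNgt; apply/negP => hd.
    by apply: h; exists delta.
  apply: (le_trans (hausdorff_premeasure_ge0 s 1 A)).
  by apply: ereal_sup_ubound; exists 1 => //=.
have [c0 c00 hc0] : exists2 c0 : R, 0 < c0 & (c0%:E <= hausdorff_premeasure s delta A)%E.
  case: (hausdorff_premeasure s delta A) hd => [c|_|//]; last by exists 1; rewrite ?leey.
  by rewrite lte_fin => c0; exists c.
have p2 : 0 < 2 `^ s :> R by exact: powR_gt0.
have pd : 0 < (delta / 2) `^ s by apply: powR_gt0; lra.
(* The first entry serves [2 * r <= delta], the second serves larger radii. *)
pose c := Num.min (Num.min (c0 / 2 `^ s) ((delta / 2) `^ s)) 1.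
have [c1 c2 c3] : [/\ c <= 1, c <= c0 / 2 `^ s & c <= (delta / 2) `^ s].
  by rewrite /c !ge_min !lexx !orbT.
exists c; first by rewrite c1 andbT /c !lt_min ltr01 pd divr_gt0.
move=> r l r0 hl; have rs : 0 < r `^ s by exact: powR_gt0.
rewrite powRN ler_pdivrMr //; have [rd|rd] := leP (2 * r) delta.
  have := le_trans hc0 (hausdorff_premeasure_covers s0 r0 rd hl).
  rewrite lee_fin powRM ?(ltW r0) // mulrCA => h.
  by apply: le_trans c2 _; rewrite ler_pdivrMr // mulrC.
have l1 : (1 : R) <= (size l)%:R.
  rewrite (ler_nat _ 1); case: A0 => x /hl[y]; by case: l {hl}.
apply: le_trans c3 _; apply: (@le_trans _ _ (r `^ s)); last by rewrite ler_peMl ?(ltW rs).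
by rewrite ge0_ler_powR ?nnegrE //; lra.
Qed.

(* A null cover for the exponent s is thickened to sets of positive size, so
   that every term carries positive weight. *)
Lemma hausdorff_measure_neq0 A (s eta : R) : A !=set0 -> 0 <= s -> 0 < eta ->
  (0 < s -> forall (U : nat -> set R) (d : nat -> R),
    (forall i x y, U i x -> U i y -> `|x - y| <= d i) -> (forall i, 0 < d i) ->
    A `<=` \bigcup_i U i ->
    ((eta `^ s)%:E <= \sum_(0 <= i <oo) (d i `^ s)%:E)%E) ->
  hausdorff_measure s A <> 0.
Proof.
move=> [a Aa] s0 eta0 hU H0.
have [e e0 he] : exists2 e : R, 0 < e & (e <= 2^-1) /\ 2 * e < eta `^ s.
  exists (Num.min 2^-1 (eta `^ s / 3)).
    by rewrite lt_min invr_gt0 ltr0n divr_gt0 ?powR_gt0.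
  split; first by rewrite ge_min lexx.
  have := powR_gt0 s eta0; have : Num.min 2^-1 (eta `^ s / 3) <= eta `^ s / 3.
    by rewrite ge_min lexx orbT.
  by lra.
have : (hausdorff_premeasure s 1 A < e%:E)%E.
  apply: (@le_lt_trans _ _ 0%E); last by rewrite lte_fin.
  by rewrite -H0; apply: ereal_sup_ubound; exists 1 => //=.
case/ereal_inf_lt => _ [U [Ud AU] <-] Ue.
have termle i : (diam_pow s (U i) <= \sum_(0 <= i <oo) diam_pow s (U i))%E.
  apply: le_trans (nneseries_lim_ge i.+1 _) => [|k _ _]; last exact: diam_pow_ge0.
  by rewrite big_nat_recr //=; apply: leeDr; apply: sume_ge0 => k _; exact: diam_pow_ge0.
(* For [s = 0] one nonempty set of the cover already weighs 1, more than [e]. *)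
move: s0; rewrite le_eqVlt => /predU1P[s0|s0].
  have [i _ Ui] := AU _ Aa; have := le_lt_trans (termle i) Ue.
  rewrite /diam_pow ifF -?s0; last by apply/eqP => U0; rewrite U0 in Ui.
  by rewrite poweRe0 lte_fin; lra.
pose D i := if U i == set0 then 0 else fine (diam (U i)).
have DE i : diam_pow s (U i) = (D i `^ s)%:E.
  rewrite /diam_pow /D; case: ifPn => [_|/set0P U0]; first by rewrite powR0 ?gt_eqF.
  by have := Ud i; have := diam_ge0 U0; case: (diam (U i)).
have D0 i : 0 <= D i.
  by rewrite /D; case: ifPn => // /set0P U0; apply: fine_ge0; exact: diam_ge0.
have Ddist i x y : U i x -> U i y -> `|x - y| <= D i.
  move=> Ux Uy; have U0 : U i !=set0 by exists x.
  rewrite /D ifF; last by apply/eqP => U0'; rewrite U0' in Ux.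
  rewrite -lee_fin fineK; first exact: diam_le_dist.
  by have := Ud i; have := diam_ge0 U0; case: (diam (U i)).
pose ee i : R := e / (2 ^ i.+1)%:R.
have ee0 i : 0 < ee i by rewrite divr_gt0 // ltr0n expn_gt0.
pose d i := (D i `^ s + ee i) `^ s^-1.
have dE i : d i `^ s = D i `^ s + ee i.
  by rewrite /d -powRrM mulVf ?gt_eqF // powRr1 // addr_ge0 ?powR_ge0 ?ltW.
have dpos i : 0 < d i by rewrite powR_gt0 // ltr_wpDl ?powR_ge0.
have Dd i : D i <= d i.
  rewrite leNgt; apply/negP => h.
  have := gt0_ltr_powR s0 _ _ h; rewrite !nnegrE (ltW (dpos i)) D0 => /(_ isT isT).
  by rewrite dE; have := ee0 i; lra.
have := hU s0 U d (fun i x y Ux Uy => le_trans (Ddist _ _ _ Ux Uy) (Dd i)) dpos AU.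
rewrite leNgt => /negP; apply.
rewrite (eq_eseriesr (g := fun i => (diam_pow s (U i) + (ee i)%:E)%E)); last first.
  by move=> i _; rewrite dE DE EFinD.
apply: le_lt_trans (epsilon_trick _ _ (ltW e0)) _ => [i|]; first exact: diam_pow_ge0.
apply: (@lt_trans _ _ (e%:E + e%:E)%E); last by rewrite -EFinD lte_fin; lra.
by rewrite lteD2rE.
Qed.

End Coverings.

Section PowerFacts.
Variable R : realType.

Lemma powR_sqrV (a t : R) : 0 <= a -> (a ^- 2) `^ t = a `^ (- (2 * t)).
Proof.
by move=> a0; rewrite -(powR_invn 2 a0) -powRrM; congr (_ `^ _); ring.
Qed.

Lemma powR_sqr (a t : R) : 0 <= a -> (a ^+ 2) `^ t = a `^ (2 * t).
Proof. by move=> a0; rewrite powRrM powR_mulrn. Qed.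

Lemma powR_nat_ge (e B : R) : 0 < e -> exists2 N : nat, (0 < N)%N & B <= N%:R `^ e.
Proof.
move=> e0; pose B' := Num.max B 0.
have B0 : 0 <= B' by rewrite le_max lexx orbT.
exists (Num.truncn (B' `^ e^-1)).+1 => //.
apply: (@le_trans _ _ B'); first by rewrite le_max lexx.
have {1}-> : B' = (B' `^ e^-1) `^ e by rewrite -powRrM mulVf ?gt_eqF // powRr1.
rewrite (ge0_ler_powR (ltW e0)) ?nnegrE ?powR_ge0 //.
exact/ltW/truncnS_gt.
Qed.

End PowerFacts.

(** * Sums over words and box counting *)

Section UpperCount.
Variables (R : realType) (I : set nat) (M b0 : nat).
Hypothesis I_ge2 : I `<=` [set n | (2 <= n)%N].
Hypothesis I_leM : I `<=` [set n | (n <= M)%N].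
Hypotheses (I_b0 : I b0) (b0_ge3 : (3 <= b0)%N).
Implicit Types (b n : nat) (w u p : seq nat) (x y z t : R).

Local Notation E := (backward_cf_set R I).
Local Notation digits_ge2 := (digits_ge2 I_ge2).
Local Notation h := (hausdorff_dim E).

Lemma cf_set_neq0 : E !=set0.
Proof.
have [_|_|zs hzs] := @cf_set_lim_words R I I_ge2 (fun=> [:: b0]).
- by rewrite /= andbT; exact: mem_set.
- by rewrite /rank /= gtn_eqF.
- by exists (zs 0%N); case: (hzs 0%N).
Qed.

(** Lowering the exponent from [t] to [s] only increases the sum, since ratios are at most 1. Thus
    [tree_cover] applies to each [s] with 0 < s < t and excludes a null measure there. *)
Lemma hausdorff_dim_ge (W : seq (seq nat)) (m : nat) t : 0 < t -> uniq W ->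
  (forall w, w \in W -> [/\ all (mem I) w, hyp w & rank w = m.+1]) ->
  1 <= \sum_(w <- W) (wratio R w / 4) `^ t -> (t%:E <= h)%E.
Proof.
move=> t0 uW hW sumW; apply: le_ereal_inf_tmp => _ [s [s0 Hs] <-].
rewrite lee_fin leNgt; apply/negP => st.
have sums : 1 <= \sum_(w <- W) (wratio R w / 4) `^ s.
  apply: le_trans sumW _; rewrite big_seq [leRHS]big_seq; apply: ler_sum => w wW.
  have [hw _ _] := hW _ wW; apply: ger_powR; last exact: ltW.
  have := wratio_gt0 R (digits_ge2 hw); have := wratio_rank R (digits_ge2 hw).
  have : (4^-1 : R) ^+ rank w <= 1 by rewrite exprn_ile1 //; lra.
  by lra.
move: (s0); rewrite le_eqVlt => /predU1P[s00|s1].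
  by apply: (hausdorff_measure_neq0 cf_set_neq0 s0 ltr01 _ Hs); rewrite -s00 ltxx.
have [eta eta0 heta] := tree_cover I_ge2 I_leM s1 uW hW sums.
by apply: (hausdorff_measure_neq0 cf_set_neq0 s0 eta0 _ Hs) => _; exact: heta.
Qed.

Hypothesis I_2 : I 2%N.

Lemma all_blkI n b : I b -> all (mem I) (blk n b).
Proof.
move=> Ib; rewrite /blk all_rcons /= mem_set //=; apply/allP => k /nseqP[-> _].
exact: mem_set.
Qed.

(* The first-level pieces have size about n^-2, so their t-weights diverge for
   t < 1/2. *)
Lemma hausdorff_dim_ge_lt_half t : 0 < t < 2^-1 -> (t%:E <= h)%E.
Proof.
move=> /andP[t0 t2].
(* Each of the first [N] blocks contributes at least [(2 * b0%:R * N%:R)]^ (- (2 *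
   t))[, so the sum is at least]N%:R [^ (1 - 2 * t) / B]. *)
pose B : R := (2 * b0%:R) `^ (2 * t).
have [|N N0 hN] := @powR_nat_ge R (1 - 2 * t) B; first lra.
apply: (@hausdorff_dim_ge [seq blk n b0 | n <- iota 0 N] 0 t) => //.
- rewrite map_inj_uniq ?iota_uniq // => n n' /(congr1 size).
  by rewrite /blk !size_rcons !size_nseq => -[].
- move=> _ /mapP[n _ ->]; split; [exact: all_blkI| |exact: rank_blk].
  by rewrite -[blk n b0]cat0s; exact: hyp_blk.
rewrite big_map; have b3 : (3 : R) <= b0%:R by rewrite ler_nat.
have NR : (0 : R) < N%:R by rewrite ltr0n.
have bN : 0 < 2 * b0%:R * N%:R :> R by apply: mulr_gt0 => //; lra.
apply: (@le_trans _ _ (\sum_(n <- iota 0 N) (2 * b0%:R * N%:R) `^ (- (2 * t)))).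
  rewrite big_const_seq count_predT size_iota iter_addr_0 -[leRHS]mulr_natr.
  have -> : (2 * b0%:R * N%:R) `^ (- (2 * t)) * N%:R = N%:R `^ (1 - 2 * t) / B.
    rewrite powRM // (@powRB _ N%:R 1) ?(gt_eqF NR) ?implybT // powRr1 // !powRN /B.
    by rewrite [RHS]mulrC mulrA mulrAC.
  by rewrite ler_pdivlMr ?mul1r // powR_gt0 //; lra.
rewrite big_seq [leRHS]big_seq; apply: ler_sum => n; rewrite mem_iota /= add0n => nN.
have nN' : (n%:R + 1 : R) <= N%:R by rewrite natr1 ler_nat.
have n0 : 0 <= n%:R :> R by [].
rewrite -powR_sqrV ?(ltW bN) //; apply: ge0_ler_powR; rewrite ?nnegrE //; first exact: ltW.
  by rewrite divr_ge0 // ltW // wratio_gt0 // all_blk ltnW.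
have nb : (b0%:R - 2) * n%:R + (b0%:R - 1) <= b0%:R * N%:R :> R by nra.
have nb0 : 0 < (b0%:R - 2) * n%:R + (b0%:R - 1) :> R by nra.
have b00 : (0 : R) < b0%:R by lra.
rewrite wratio_blk -invfM lef_pV2 ?posrE ?mulr_gt0 ?exprn_gt0 //.
rewrite -[4]/(4%:R) -mulrA exprMn (_ : 2 ^+ 2 = 4 :> R); last by ring.
by rewrite mulrC ler_pM2l // ler_sqr ?nnegrE //; exact: ltW.
Qed.

Lemma hausdorff_dim_ge_half : ((2^-1)%:E <= h)%E.
Proof.
rewrite leNgt; apply/negP => h2.
have h4 : ((4^-1)%:E <= h)%E by apply: hausdorff_dim_ge_lt_half; lra.
have {h4 h2} [k hk [k4 k2]] : exists2 k : R, h = k%:E & 4^-1 <= k /\ k < 2^-1.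
  by case: h h4 h2 => [k||] //; rewrite lee_fin lte_fin => ? ?; exists k.
have : (((k + 2^-1) / 2)%:E <= h)%E by apply: hausdorff_dim_ge_lt_half; lra.
by rewrite hk lee_fin; lra.
Qed.

Lemma sum_rank_le t (l : seq (seq nat)) m : (h < t%:E)%E -> uniq l ->
  (forall w, w \in l -> [/\ all (mem I) w, hyp w & rank w = m]) ->
  \sum_(w <- l) wratio R w `^ t <= 4 `^ t.
Proof.
move=> ht ul hl.
have t0 : 0 < t.
  by have := le_lt_trans hausdorff_dim_ge_half ht; rewrite lte_fin; lra.
case: m hl => [|m] hl.
  apply: (@le_trans _ _ 1); last by rewrite -[leLHS](powRr0 4) ler_powR //; lra.
  have : (size l <= size [:: [::] : seq nat])%N.
    apply: uniq_leq_size => // w /hl[_ hw rw].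
    by rewrite -(@prefix_hyp_rank [::] w) ?rw ?prefix0s ?mem_head.
  case: l ul hl => [|w [|//]] _ hl _; first by rewrite big_nil; lra.
  have [hw _ _] := hl w (mem_head _ _); rewrite big_seq1 -(powRr0 (wratio R w)).
  have r0 := wratio_gt0 R (digits_ge2 hw); have := wratio_rank R (digits_ge2 hw).
  have : (4^-1 : R) ^+ rank w <= 1 by rewrite exprn_ile1 //; lra.
  by move=> h1 h2; apply: ger_powR; [apply/andP; split; lra|exact: ltW].
rewrite leNgt; apply/negP => hlt.
suff : (t%:E <= h)%E by rewrite leNgt ht.
apply: (@hausdorff_dim_ge l m t) => //.
have hsum : \sum_(w <- l) (wratio R w / 4) `^ t = (\sum_(w <- l) wratio R w `^ t) / 4 `^ t.
  rewrite mulr_suml big_seq [RHS]big_seq; apply: eq_bigr => w /hl[hw _ _].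
  rewrite (powRM _ (ltW (wratio_gt0 R (digits_ge2 hw)))) ?invr_ge0 //.
  by congr (_ * _); rewrite -(powR_inv1 (ler0n R 4)) -powRrM mulN1r powRN.
by rewrite hsum ler_pdivlMr ?powR_gt0 ?mul1r // ltW.
Qed.

End UpperCount.

Section WordSums.
Variables (R : realType) (I : set nat) (M b0 : nat).
Hypothesis I_ge2 : I `<=` [set n | (2 <= n)%N].
Hypothesis I_leM : I `<=` [set n | (n <= M)%N].
Hypotheses (I_b0 : I b0) (b0_ge3 : (3 <= b0)%N) (I_2 : I 2%N).
Implicit Types (b n : nat) (w u p : seq nat) (x y z t r : R).

Local Notation E := (backward_cf_set R I).
Local Notation digits_ge2 := (digits_ge2 I_ge2).
Local Notation h := (hausdorff_dim E).

Definition hword w := all (mem I) w && hyp w.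

Lemma wratio_le1 w : all (leq 2) w -> wratio R w <= 1.
Proof.
move=> hw; rewrite (le_trans (wratio_rank R hw)) // exprn_ile1 //; lra.
Qed.

Lemma geometric_le (q : R) n : 0 <= q < 1 -> \sum_(i < n) q ^+ i <= (1 - q)^-1.
Proof.
move=> q01; rewrite -[leRHS]mul1r ler_pdivlMr; last lra.
have := subrX1 q n; have : 0 <= q ^+ n by rewrite exprn_ge0; lra.
by nra.
Qed.

(** Words of rank [j] have ratio at most 4^-j, so the surplus exponent [t - t0] gains a factor
    [q ^+ j] over the uniform bound, and the ranks sum geometrically. *)
Lemma sum_words_le t0 t : (h < t0%:E)%E -> t0 < t ->
  exists2 D : R, 0 < D & forall l : seq (seq nat), uniq l -> all hword l ->
    \sum_(w <- l) wratio R w `^ t <= D.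
Proof.
move=> ht0 t0t; set q : R := (4^-1) `^ (t - t0).
have q01 : 0 <= q < 1.
  rewrite powR_ge0 /=; have e0 : 0 < t - t0 by lra.
  have := @gt0_ltr_powR R _ e0 4^-1 1; rewrite !nnegrE powR1; apply => //; lra.
exists (4 `^ t0 * (1 - q)^-1).
  by rewrite mulr_gt0 ?invr_gt0 ?powR_gt0 //; lra.
move=> l ul /allP hl.
set N := \max_(w <- l) rank w.
rewrite big_seq (partition_big (fun w => inord (rank w) : 'I_N.+1) predT) //=.
apply: (@le_trans _ _ (\sum_(j < N.+1) 4 `^ t0 * q ^+ j)); last first.
  by rewrite -mulr_sumr ler_wpM2l ?powR_ge0 // geometric_le.
apply: ler_sum => j _.
have hN w : w \in l -> (rank w < N.+1)%N by move=> wl; rewrite ltnS; exact: leq_bigmax_seq.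
rewrite (eq_bigl (fun w => (w \in l) && (rank w == j))); last first.
  move=> w; apply: andb_id2l => wl; rewrite -val_eqE /= inordK //; exact: hN.
rewrite -big_seq_cond -big_filter.
set l' := [seq w <- l | _].
have hl' w : w \in l' -> [/\ all (mem I) w, hyp w & rank w = j].
  by rewrite mem_filter => /andP[/eqP -> /hl /andP[]].
apply: (@le_trans _ _ (\sum_(w <- l') wratio R w `^ t0 * q ^+ j)); last first.
  rewrite -mulr_suml ler_wpM2r ?exprn_ge0 //; first by case/andP: q01.
  by apply: (sum_rank_le I_ge2 I_leM I_b0 b0_ge3 I_2 ht0 _ hl'); exact: filter_uniq.
rewrite big_seq [leRHS]big_seq; apply: ler_sum => w /hl'[hw _ rw].
have r0 := wratio_gt0 R (digits_ge2 hw).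
have -> : wratio R w `^ t = wratio R w `^ t0 * wratio R w `^ (t - t0).
  by rewrite -powRD ?(gt_eqF r0) ?implybT //; congr (_ `^ _); ring.
rewrite ler_wpM2l ?powR_ge0 //.
rewrite -powR_mulrn ?powR_ge0 // /q powRAC powR_mulrn //.
rewrite ge0_ler_powR ?nnegrE ?exprn_ge0 ?(ltW r0) //; try lra.
by rewrite -rw; exact: wratio_rank (digits_ge2 hw).
Qed.

Lemma words_above t (D r : R) : 0 <= t -> 0 < D -> 0 < r ->
  (forall l : seq (seq nat), uniq l -> all hword l ->
    \sum_(w <- l) wratio R w `^ t <= D) ->
  exists l : seq (seq nat), [/\ uniq l, all hword l,
    forall w, w \in l -> r <= wratio R w &
    forall w, hword w -> r <= wratio R w -> w \in l].
Proof.
move=> t0 D0 r0 hD; apply: contrapT => hno.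
have hex n : exists l : seq (seq nat), [/\ uniq l, all hword l,
    forall w, w \in l -> r <= wratio R w & size l = n].
  elim: n => [|n [l [ul hl rl sl]]]; first by exists [::].
  have [w hw] : exists w, [/\ hword w, r <= wratio R w & w \notin l].
    apply: contrapT => hn; apply: hno; exists l; split=> // w hw rw.
    by apply: contrapT => /negP wl; apply: hn; exists w.
  case: hw => hw rw wl; exists (w :: l); rewrite /= wl ul hw hl sl; split=> // v.
  by rewrite inE => /predU1P[->|/rl].
have rt : 0 < r `^ t by exact: powR_gt0.
have [l [ul hl rl sl]] := hex (Num.truncn (D / r `^ t)).+1.
have : (size l)%:R * r `^ t <= D.
  apply: le_trans (hD _ ul hl).
  have -> : (size l)%:R * r `^ t = \sum_(w <- l) r `^ t.
    by rewrite big_const_seq count_predT iter_addr_0 mulr_natl.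
  rewrite big_seq [leRHS]big_seq; apply: ler_sum => w /rl rw.
  by rewrite ge0_ler_powR ?nnegrE ?(ltW r0) // (le_trans (ltW r0)).
rewrite -ler_pdivlMr // sl leNgt => /negP; apply; exact: truncnS_gt.
Qed.

(** [T] is the jump transformation past the neutral digit: [dig z] records the first block of [z]
    and [T z] is what follows it. *)
Definition coding (dig : R -> nat * nat) (T : R -> R) := forall z, E z ->
  [/\ I (dig z).2, (3 <= (dig z).2)%N, E (T z) & z = wmap (blk (dig z).1 (dig z).2) (T z)].

Lemma coding_exists : exists dig T, coding dig T.
Proof.
have [f hf] : {f : R -> (nat * nat) * R & forall z, E z ->
    [/\ I (f z).1.2, (3 <= (f z).1.2)%N, E (f z).2 &
      z = wmap (blk (f z).1.1 (f z).1.2) (f z).2]}.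
  apply: (@choice _ _ (fun z q => E z -> [/\ I q.1.2, (3 <= q.1.2)%N, E q.2 &
      z = wmap (blk q.1.1 q.1.2) q.2])) => z.
  have [Ez|nEz] := pselect (E z); last by exists ((0, 0)%N, 0).
  by have [n [b [y [? ? ? ?]]]] := cf_set_blk I_ge2 Ez; exists ((n, b), y).
by exists (fun z => (f z).1), (fun z => (f z).2).
Qed.

Section Coding.
Variables (dig : R -> nat * nat) (T : R -> R).
Hypothesis cod : coding dig T.

Definition code_block z := blk (dig z).1 (dig z).2.

Fixpoint code k z : seq nat := if k is j.+1 then code_block z ++ code j (T z) else [::].

Lemma cf_set_iter k z : E z -> E (iter k T z).
Proof. by move=> Ez; elim: k => //= k /cod[]. Qed.

Lemma preS k z : code k.+1 z = code k z ++ code_block (iter k T z).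
Proof.
elim: k z => [|k IH] z; first by rewrite /= cats0.
by rewrite -[in LHS]/(code k.+2 z) [LHS]/= -[code_block (T z) ++ _]/(code k.+1 (T z)) IH catA -iterSr.
Qed.

Lemma hword_lblk w z : E z -> hword w -> hword (w ++ code_block z).
Proof.
move=> /cod[Ib b3 _ _] /andP[hw hyw].
by rewrite /hword all_cat hw /= hyp_blk ?hyp_all // andbT; exact: all_blkI.
Qed.

Lemma hword_pre k z : E z -> hword (code k z) /\ rank (code k z) = k.
Proof.
move=> Ez; elim: k => [|k [IH rk]]; first by [].
have Ek := cf_set_iter k Ez; rewrite preS; split; first exact: hword_lblk.
by have [_ b3 _ _] := cod Ek; rewrite rank_cat rk rank_blk // addn1.
Qed.

Lemma pre_wmap k z : E z -> z = wmap (code k z) (iter k T z).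
Proof.
move=> Ez; elim: k => [//|k IH].
have [_ _ _ zk] := cod (cf_set_iter k Ez).
by rewrite preS wmap_cat -zk.
Qed.

(* Points whose next block is too small at scale r sit in a short interval at
   the parabolic end of the piece of w. *)
Lemma terminal_interval w n b v r : hword w -> I b -> (3 <= b)%N -> E v ->
  0 < r -> wratio R (w ++ blk n b) < r ->
  wmap w 0 <= wmap w (wmap (blk n b) v)
    <= wmap w 0 + 2 * M%:R * r * (wratio R w / r) `^ 2^-1.
Proof.
move=> /andP[/digits_ge2 hw hyw] Ib b3 Ev r0 hr.
have b2 : all (leq 2) (blk n b) by rewrite all_blk ltnW.
have v01 := cf_set_01 Ev; have v0 : 0 <= v by lra.
have u0 := wmap_ge0 b2 v0.
rewrite wmap_homo //= -lerBlDl.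
have L0 := wratio_gt0 R hw; set L := wratio R w in L0 *.
have Lr : 0 <= L / r by rewrite divr_ge0 // ltW.
apply: le_trans (ler_norm _) _; apply: le_trans (wmap_lip hw u0 (lexx 0)) _.
rewrite subr0 (ger0_norm u0) -/L.
have /andP[_ u1] := wmap_blk_bounds n b3 v0; set u := wmap _ v in u0 u1 *.
rewrite -ler_sqr ?nnegrE ?mulr_ge0 ?powR_ge0 ?(ltW r0) ?(ltW L0) //.
rewrite !exprMn -(powR_mulrn 2 (powR_ge0 _ _)) -powRrM mulVf // powRr1 //.
have h1 : 0 <= (wden R w).1 <= (wden R w).2 /\ 1 <= (wden R w).2.
  by have [-> ->] := wden_ge R hw; rewrite wden_hyp.
have bM : (b%:R : R) <= M%:R by rewrite ler_nat; exact: I_leM.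
have b3' : (3 : R) <= b%:R by rewrite ler_nat.
have n0 : 0 <= n%:R :> R by [].
move: hr u1; rewrite /L /wratio wden_blk /=; rewrite -[n.+1%:R]natr1.
move: (wden R w).1 (wden R w).2 h1 => p s [/andP[p0 ps] s1] hr u1.
set q := _ + _ in hr.
(* [q] is the second entry of the bottom row for [w ++ blk n b]; here [p <= s] is the bounded
   distortion of [w]. *)
have qle : q <= M%:R * (s * (n%:R + 2)).
  apply: (@le_trans _ _ (b%:R * (s * (n%:R + 2)))); last first.
    by rewrite ler_wpM2r // mulr_ge0; lra.
  have h1 : 0 <= (b%:R - 2) * (s - p) by rewrite mulr_ge0; lra.
  have h2 : 0 <= n%:R * s by rewrite mulr_ge0 //; lra.
  rewrite -subr_ge0 /q (_ : _ - _ = (b%:R - 2) * (s - p) + 2 * (n%:R * s) + 3 * s); last by ring.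
  by lra.
have q0 : 0 < q.
  have h1 : 0 <= (b%:R - 2) * (p + n%:R * s).
    have h0 : 0 <= n%:R * s by rewrite mulr_ge0 //; lra.
    by apply: mulr_ge0; lra.
  have h2 : 0 < (b%:R - 1) * s by rewrite mulr_gt0; lra.
  by rewrite /q; lra.
have {}hr : 1 <= r * (M%:R * (s * (n%:R + 2))) ^+ 2.
  apply: (@le_trans _ _ (r * q ^+ 2)).
    by rewrite mulrC -ler_pdivrMl ?exprn_gt0 // mulr1 ltW.
  by rewrite ler_pM2l // ler_sqr ?nnegrE ?(ltW q0) // (le_trans (ltW q0)).
have u2 : u ^+ 2 <= (n%:R + 1) ^- 2.
  by rewrite -exprVn ler_sqr ?nnegrE // invr_ge0; lra.
have s2 : 0 < s ^+ 2 by rewrite exprn_gt0 //; lra.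
have n2 : 0 < (n%:R + 1) ^+ 2 :> R by rewrite exprn_gt0 //; lra.
(* From [n + 2 <= 2 * (n + 1)] it follows that u <= 2 M s r^(1/2); multiplying by L = s^-2 gives the
   length 2 M (r L)^(1/2). *)
have {}u2 : u ^+ 2 <= 4 * (r * M%:R ^+ 2 * s ^+ 2).
  apply: (le_trans u2); rewrite -[leLHS]mulr1 ler_pdivrMl //.
  apply: (le_trans hr); rewrite !exprMn.
  have : 0 <= r * M%:R ^+ 2 * s ^+ 2 by rewrite (mulr_ge0 (mulr_ge0 (ltW r0) _) (ltW s2)) // exprn_ge0.
  have -> : r * (M%:R ^+ 2 * (s ^+ 2 * (n%:R + 2) ^+ 2)) =
     r * M%:R ^+ 2 * s ^+ 2 * (n%:R + 2) ^+ 2 by ring.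
  have -> : (n%:R + 1) ^+ 2 * (4 * (r * M%:R ^+ 2 * s ^+ 2)) =
     r * M%:R ^+ 2 * s ^+ 2 * (4 * (n%:R + 1) ^+ 2) by ring.
  move=> h0; rewrite ler_wpM2l // !expr2; nra.
apply: (@le_trans _ _ ((s ^- 2) ^+ 2 * (4 * (r * M%:R ^+ 2 * s ^+ 2)))).
  by apply: ler_wpM2l u2; rewrite ?exprn_ge0 ?invr_ge0 ?(ltW s2).
rewrite le_eqVlt; apply/orP; left; apply/eqP; field.
by rewrite !gt_eqF //; lra.
Qed.

Lemma wratio_pre_lt k z r : E z -> 4^-1 ^+ k < r -> wratio R (code k z) < r.
Proof.
move=> Ez; have [/andP[hw _] rk] := hword_pre k Ez.
by apply: le_lt_trans; rewrite -{2}rk; exact: wratio_rank (digits_ge2 hw).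
Qed.

Lemma expn4_lt r : 0 < r -> exists k, 4^-1 ^+ k < r.
Proof.
move=> r0; have [k _ /(_ k (leqnn k)) /= hk] := near_infty_natSinv_expn_lt (PosNum r0).
exists k; apply: le_lt_trans hk; rewrite div1r -exprVn.
by rewrite lerXn2r ?nnegrE ?invr_ge0 // lef_pV2 ?posrE //; lra.
Qed.

Lemma last_large_prefix z r : E z -> 0 < r <= 1 ->
  exists k, r <= wratio R (code k z) /\ wratio R (code k.+1 z) < r.
Proof.
move=> Ez /andP[r0 r1].
have hex : exists k, wratio R (code k z) < r.
  by have [k hk] := expn4_lt r0; exists k; exact: wratio_pre_lt.
case: (ex_minnP hex) => [[|k] hk hmin]; first by move: hk; rewrite /= wratio_nil; lra.
by exists k; split => //; rewrite leNgt; apply/negP => /hmin; rewrite ltnn.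
Qed.

(** A terminal interval costs about (L_w / r)^(1/2) balls, and this is at most (L_w / r)^t because
    L_w >= r and t >= 1/2. Every point lies in the interval of its last prefix of ratio at least
    [r]. *)
Lemma upper_count t D : 2^-1 <= t -> 0 < D ->
  (forall l : seq (seq nat), uniq l -> all hword l ->
    \sum_(w <- l) wratio R w `^ t <= D) ->
  forall r, 0 < r <= 1 -> coverable r E ((2 * M%:R + 1) * D * r `^ (- t)).
Proof.
move=> t2 D0 hD r r01; have /andP[r0 r1] := r01.
have [|l [ul hl rl inl]] := words_above _ D0 r0 hD.
  by apply: le_trans t2; rewrite invr_ge0.
pose P w : set R := [set x | wmap w 0 <= x <=
  wmap w 0 + 2 * M%:R * r * (wratio R w / r) `^ 2^-1].
pose N w : R := (2 * M%:R + 1) * (wratio R w / r) `^ t.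
have hlw w : w \in l -> 1 <= wratio R w / r.
  by move=> /rl rw; rewrite ler_pdivlMr // mul1r.
have covP w : w \in l -> coverable r (P w) (N w).
  move=> /hlw wr; have pt : 1 <= (wratio R w / r) `^ t.
    by rewrite -[leLHS](powRr0 (wratio R w / r)) ler_powR //; lra.
  apply: (@cov_le _ _ _ (2 * M%:R * r * (wratio R w / r) `^ 2^-1 / r + 1)).
    have := ler_powR wr t2.
    have -> : 2 * M%:R * r * (wratio R w / r) `^ 2^-1 / r = 2 * M%:R * (wratio R w / r) `^ 2^-1.
      by field; rewrite gt_eqF.
    move=> h2; have h3 := ler_wpM2l (ler0n R (2 * M)) h2.
    by move: h3; rewrite natrM /N; lra.
  by apply: (@cov_interval _ _ _ (wmap w 0)) => //; rewrite !mulr_ge0 ?powR_ge0 ?(ltW r0).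
have := @cov_bigcup R _ l P N r E covP.
have -> : \sum_(w <- l) N w = (2 * M%:R + 1) * ((\sum_(w <- l) wratio R w `^ t) * r `^ (- t)).
  rewrite mulr_suml mulr_sumr big_seq [RHS]big_seq; apply: eq_bigr => w wl.
  rewrite /N (powRM _ (le_trans (ltW r0) (rl _ wl))) ?invr_ge0 ?(ltW r0) //.
  by rewrite -[r^-1](powR_inv1 (ltW r0)) -powRrM mulN1r.
move=> hc; apply: cov_le (hc _) => [|z Ez].
  by rewrite -mulrA ler_wpM2l ?addr_ge0 ?mulr_ge0 // ler_wpM2r ?powR_ge0 // hD.
have [k [h1 h2]] := last_large_prefix Ez r01.
have [hw rk] := hword_pre k Ez; have Ek := cf_set_iter k Ez.
have [Ib b3 Ev zk] := cod Ek.
exists (code k z); first exact: inl.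
rewrite preS in h2; have := terminal_interval hw Ib b3 Ev r0 h2.
by rewrite -zk -pre_wmap.
Qed.

End Coding.
End WordSums.

(** * Covering a ball *)

Section PowerSums.
Variable R : realType.
Implicit Types (a x y : R).

(** The right-hand side is the integral of y^-(1+a) over [x, x + 1]. The inequality follows from ln
    (1 + 1/x) >= 1/(x + 1) and e^u >= 1 + u. *)
Lemma powR_step a x : 0 < a -> 0 < x ->
  (x + 1) `^ (- (1 + a)) <= a^-1 * (x `^ (- a) - (x + 1) `^ (- a)).
Proof.
move=> a0 x0; have x1 : 0 < x + 1 by lra.
have E1 : (x + 1) `^ (- (1 + a)) = (x + 1) `^ (- a) * (x + 1)^-1.
  rewrite -[(x + 1)^-1](powR_inv1 (ltW x1)) -powRD ?(gt_eqF x1) ?implybT //.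
  by congr (_ `^ _); ring.
have E2 : x `^ (- a) = (x + 1) `^ (- a) * ((x + 1) / x) `^ a.
  rewrite powRM ?invr_ge0 ?ltW // mulrA -powRD ?(gt_eqF x1) ?implybT //.
  by rewrite addNr powRr0 mul1r -[x^-1](powR_inv1 (ltW x0)) -powRrM mulN1r.
have P := powR_gt0 (- a) x1.
rewrite E1 E2 ler_pdivlMl // mulrCA.
rewrite -[X in _ <= _ - X]mulr1 -mulrBr ler_pM2l //.
have y0 : 0 < (x + 1) / x by rewrite divr_gt0.
have hl : (x + 1)^-1 <= ln ((x + 1) / x).
  rewrite -[(x + 1) / x]invrK lnV ?posrE ?invr_gt0 // lerNr.
  have -> : ((x + 1) / x)^-1 = 1 + - (x + 1)^-1.
    by field; rewrite !gt_eqF //; lra.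
  apply: le_ln1Dx; rewrite ltrN2 invf_lt1 //; lra.
rewrite /powR (gt_eqF y0).
apply: le_trans (_ : a * ln ((x + 1) / x) <= _); first by rewrite ler_pM2l.
by rewrite lerBrDl; exact: expR_ge1Dx.
Qed.

(** Subadditivity of the power: the fractions (x - y)/x and y/x sum to 1, and each is at most its
    own power [a]. *)
Lemma powR_sub_le a x y : 0 < a <= 1 -> 0 < y <= x ->
  x `^ a - y `^ a <= (x - y) `^ a.
Proof.
move=> /andP[a0 a1] /andP[y0 yx]; have x0 : 0 < x by lra.
move: yx; rewrite le_eqVlt => /predU1P[->|yx].
  by rewrite !subrr powR0 // gt_eqF.
have d0 : 0 < x - y by lra.
have u : (x - y) / x <= ((x - y) / x) `^ a.
  apply: ger1_powR => //; rewrite divr_gt0 //= ler_pdivrMr ?mul1r //; lra.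
have v : y / x <= (y / x) `^ a.
  apply: ger1_powR => //; rewrite divr_gt0 //= ler_pdivrMr ?mul1r //; lra.
have s1 : (x - y) / x + y / x = 1 by field; rewrite gt_eqF.
have E1 z : 0 < z -> z `^ a = (z / x) `^ a * x `^ a.
  by move=> z0; rewrite -powRM ?divfK ?gt_eqF ?divr_ge0 ?ltW.
rewrite (E1 _ y0) (E1 _ d0) -{1}[x `^ a]mul1r -mulrBl.
by apply: ler_wpM2r; [exact: powR_ge0|lra].
Qed.

Lemma sum_powR_le a m n : 0 < a -> (m <= n)%N ->
  \sum_(m <= k < n.+1) (k.+1%:R : R) `^ (- (1 + a)) <=
  m.+1%:R `^ (- (1 + a)) + a^-1 * (m.+1%:R `^ (- a) - n.+1%:R `^ (- a)).
Proof.
move=> a0; elim: n => [|n IH] mn.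
  have -> : m = 0%N by case: m mn.
  by rewrite big_nat1 subrr mulr0 addr0.
move: mn; rewrite leq_eqVlt => /predU1P[->|].
  by rewrite big_nat1 subrr mulr0 addr0.
rewrite ltnS => mn; rewrite big_nat_recr ?(leqW mn) //=.
have := @powR_step a n.+1%:R a0 (ltr0Sn _ _); rewrite natr1.
by have := IH mn; lra.
Qed.

(* A run m..n of parabolic pieces met by a set of diameter at most rho. *)
Lemma sum_run_le a m n (rho kap : R) : 0 < a <= 1 -> (m <= n)%N -> 0 < rho ->
  0 < kap -> m.+1%:R ^- 2 <= rho / kap -> m.+2%:R^-1 - n.+1%:R^-1 <= rho ->
  \sum_(m <= k < n.+1) (k.+1%:R : R) `^ (- (1 + a)) <=
  ((kap^-1) `^ a + a^-1 * (1 + kap^-1) `^ a) * rho `^ a.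
Proof.
move=> /andP[a0 a1] mn rho0 k0 h1 h2.
have kV : 0 < kap^-1 by rewrite invr_gt0.
apply: le_trans (sum_powR_le a0 mn) _; rewrite mulrDl; apply: lerD.
  rewrite -powRM ?(ltW kV) ?(ltW rho0) // [kap^-1 * rho]mulrC.
  apply: (@le_trans _ _ ((m.+1%:R ^- 2) `^ a)).
    rewrite powR_sqrV // ler_powR ?(ler_nat _ 1) //; lra.
  by rewrite ge0_ler_powR ?nnegrE ?(ltW a0) // (le_trans _ h1).
rewrite -mulrA ler_wpM2l ?invr_ge0 ?(ltW a0) //.
rewrite -powRM ?addr_ge0 ?(ltW kV) ?(ltW rho0) //.
have V k : k.+1%:R `^ (- a) = (k.+1%:R^-1) `^ a :> R.
  by rewrite -[k.+1%:R^-1]powR_inv1 // -powRrM mulN1r.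
rewrite !V; apply: le_trans (powR_sub_le _ _) _; first by rewrite a0.
  by rewrite invr_gt0 ltr0Sn lef_pV2 ?posrE ?ltr0Sn // ler_nat.
have d0 : n.+1%:R^-1 <= m.+1%:R^-1 :> R by rewrite lef_pV2 ?posrE ?ltr0Sn // ler_nat.
(* The hypothesis on the run starts at 1/(m+2), the telescoped sum at 1/(m+1); their gap is absorbed
   by the bound on (m+1)^-2. *)
have h3 : m.+1%:R^-1 - m.+2%:R^-1 <= m.+1%:R ^- 2 :> R.
  rewrite -[m.+2%:R]natr1; have : (0 : R) < m.+1%:R by [].
  move: (m.+1%:R : R) => x x0.
  have -> : x^-1 - (x + 1)^-1 = (x * (x + 1))^-1.
    by field; rewrite !gt_eqF //; lra.
  have x1 : 0 < x * (x + 1) by rewrite mulr_gt0; lra.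
  by rewrite lef_pV2 ?posrE ?exprn_gt0 // expr2 ler_pM2l //; lra.
rewrite ge0_ler_powR ?nnegrE ?(ltW a0) ?subr_ge0 //; last first.
  rewrite mulrDl mul1r [kap^-1 * _]mulrC.
  move: h1 h2 h3; move: (m.+1%:R^-1) (m.+2%:R^-1) (n.+1%:R^-1) (m.+1%:R ^- 2).
  by move=> A B C D; move: (rho / kap) => F; lra.
by rewrite mulr_ge0 ?addr_ge0 ?(ltW kV) ?(ltW rho0).
Qed.

End PowerSums.

(** * Counting in a set whose points have different first blocks *)

Section LocalCount.
Variables (R : realType) (I : set nat) (M b0 : nat).
Hypothesis I_ge2 : I `<=` [set n | (2 <= n)%N].
Hypothesis I_leM : I `<=` [set n | (n <= M)%N].
Hypotheses (I_b0 : I b0) (b0_ge3 : (3 <= b0)%N) (I_2 : I 2%N).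
Implicit Types (b n : nat) (w u p : seq nat) (x y z t r rho : R).

Local Notation E := (backward_cf_set R I).
Local Notation digits_ge2 := (digits_ge2 I_ge2).

Lemma wmap_nseq_colip n x y : 0 <= x <= 1 -> 0 <= y <= 1 ->
  n.+1%:R ^- 2 * `|x - y| <= `|wmap (nseq n 2%N) x - wmap (nseq n 2%N) y|.
Proof.
move=> /andP[x0 x1] /andP[y0 y1].
have h2 : all (leq 2) (nseq n 2%N) by rewrite all_nseq orbT.
rewrite wmap_sub // -[nseq n _]cat0s wden_nseq /wden /= add0r !mulr1.
have n0 : 0 <= n%:R :> R by [].
have nx : 0 <= n%:R * x <= n%:R by rewrite mulr_ge0 //= ler_piMr.
have ny : 0 <= n%:R * y <= n%:R by rewrite mulr_ge0 //= ler_piMr.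
have D0 : 0 < (1 + n%:R * x) * (1 + n%:R * y) by rewrite mulr_gt0; lra.
rewrite normrM normfV (gtr0_norm D0) mulrC ler_wpM2l //.
rewrite lef_pV2 ?posrE ?exprn_gt0 // expr2 -[n.+1%:R]natr1.
by apply: ler_pM; lra.
Qed.

(** After the common run of [n] digits 2 the next digits differ: [b] against 2 if [n < n'], against
    [b'] otherwise. The constant is that of [words_sep] for a one-digit word, and the run contracts
    by no more than (n+1)^-2. *)
Lemma blk_sep n b n' b' v v' : (n <= n')%N -> I b -> (3 <= b)%N -> I b' ->
  (3 <= b')%N -> E v -> E v' -> (n, b) != (n', b') ->
  M%:R ^- 5 * n.+1%:R ^- 2 <= `|wmap (blk n b) v - wmap (blk n' b') v'|.
Proof.
move=> nn' Ib b3 Ib' b3' Ev Ev' nb.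
have -> : blk n' b' = nseq n 2%N ++ blk (n' - n) b'.
  by rewrite /blk -rcons_cat -nseqD subnKC.
have -> : blk n b = nseq n 2%N ++ [:: b] by rewrite cats1.
rewrite !wmap_cat.
have hb : all (mem I) [:: b] by rewrite /= andbT; exact: mem_set.
have hb' : all (mem I) (blk (n' - n) b') by exact: all_blkI.
have v01 := cf_set_core I_ge2 I_leM Ev; have v01' := cf_set_core I_ge2 I_leM Ev'.
have c1 := core_le1 (core_wmap I_ge2 I_leM hb v01).
have c2 := core_le1 (core_wmap I_ge2 I_leM hb' v01').
apply: le_trans (wmap_nseq_colip n c1 c2); rewrite mulrC ler_wpM2l //.
have pre1 : ~~ prefix [:: b] (blk (n' - n) b') && ~~ prefix (blk (n' - n) b') [:: b].
  move: nb; rewrite /blk; case E' : (n' - n)%N => [|k] /=.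
    have -> : n' = n by apply/eqP; rewrite eqn_leq nn' -subn_eq0 E'.
    by rewrite xpair_eqE eqxx /= => bb'; rewrite ?prefix0s ?andbT [b' == b]eq_sym bb'.
  by rewrite [2%N == b]eq_sym (gtn_eqF b3).
case/andP: pre1 => p1 p2.
apply: le_trans (words_sep I_ge2 I_leM hb hb' p1 p2 v01 v01').
by rewrite expr1 -invfM -exprD.
Qed.

Lemma wratio_blk_le n b : (3 <= b)%N -> wratio R (blk n b) <= n.+1%:R ^- 2.
Proof.
move=> b3; have : (3 : R) <= b%:R by rewrite ler_nat.
have : 0 <= n%:R :> R by [].
rewrite wratio_blk -[n.+1%:R]natr1; move: (n%:R : R) (b%:R : R) => x y x0 y3.
have x1 : 0 < x + 1 by lra.
have h1 : x + 1 <= (y - 2) * x + (y - 1) by nra.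
have q0 := lt_le_trans x1 h1.
by rewrite lef_pV2 ?posrE ?exprn_gt0 // ler_sqr ?nnegrE ?(ltW x1) ?(ltW q0).
Qed.

Section Coding.
Variables (dig : R -> nat * nat) (T : R -> R).
Hypothesis cod : coding I dig T.

(** Points with a small first block fill a short interval at 0. The others lie in pieces of indices
    [m] to [n], and rescaling the global count to a piece of index k costs r^-t (k+1)^(-2t);
    [sum_run_le] adds these up. *)
Lemma local_count t C1 : 2^-1 < t <= 1 -> 0 < C1 ->
  (forall r, 0 < r <= 1 -> coverable r E (C1 * r `^ (- t))) ->
  exists2 C : R, 0 < C & forall (A : set R) r rho, A `<=` E -> 0 < rho ->
    (forall x y, A x -> A y -> `|x - y| <= rho) ->
    (exists x y, [/\ A x, A y & dig x <> dig y]) ->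
    0 < r <= 1 -> r <= rho ^+ 2 ->
    coverable r A (C * (r `^ (- t) * rho `^ (2 * t - 1))).
Proof.
move=> /andP[t2 t1] C10 hC1.
have a0 : 0 < 2 * t - 1 by lra.
have a1 : 2 * t - 1 <= 1 by lra.
pose kap : R := M%:R ^- 5.
have MR : (3 : R) <= M%:R by rewrite ler_nat (leq_trans b0_ge3) // I_leM.
have k0 : 0 < kap by rewrite invr_gt0 exprn_gt0 //; lra.
pose K := (kap^-1) `^ (2 * t - 1) + (2 * t - 1)^-1 * (1 + kap^-1) `^ (2 * t - 1).
have K0 : 0 <= K.
  by rewrite addr_ge0 ?powR_ge0 // mulr_ge0 ?powR_ge0 // invr_ge0 ltW.
exists ((2 * M%:R + 1) + C1 * (M.+1%:R * K)).
  have : 0 <= C1 * (M.+1%:R * K) by rewrite !mulr_ge0 ?(ltW C10).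
  by lra.
move=> A r rho AE rho0 Adiam Atwo /andP[r0 r1] rrho.
have cA x : A x -> [/\ I (dig x).2, (3 <= (dig x).2)%N, E (T x) &
    x = wmap (blk (dig x).1 (dig x).2) (T x)] by move=> /AE /cod.
pose large x := r <= wratio R (code_block dig x).
pose A1 := A `&` [set x | ~~ large x].
pose A2 := A `&` [set x | large x].
have cov1 : coverable r A1 ((2 * M%:R + 1) * (r `^ (- t) * rho `^ (2 * t - 1))).
  apply: (@cov_le _ _ _ (2 * M%:R * r * (1 / r) `^ 2^-1 / r + 1)).
    have -> : 2 * M%:R * r * (1 / r) `^ 2^-1 / r = 2 * M%:R * r `^ (- 2^-1).
      have -> : (1 / r) `^ 2^-1 = r `^ (- 2^-1).
        by rewrite div1r -powR_inv1 ?(ltW r0) // -powRrM mulN1r.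
      by field; rewrite gt_eqF.
    have h1 : 1 <= r `^ (- 2^-1).
      by rewrite -[leLHS](powRr0 r) ger_powR ?r0 //; lra.
    have h2 : r `^ (- 2^-1) <= r `^ (- t) * rho `^ (2 * t - 1).
      have -> : r `^ (- 2^-1) = r `^ (- t) * r `^ (t - 2^-1).
        by rewrite -powRD ?(gt_eqF r0) ?implybT //; congr (_ `^ _); ring.
      rewrite ler_wpM2l ?powR_ge0 //.
      have -> : rho `^ (2 * t - 1) = (rho ^+ 2) `^ (t - 2^-1).
        by rewrite powR_sqr ?(ltW rho0) //; congr (_ `^ _); field.
      by rewrite ge0_ler_powR ?nnegrE ?exprn_ge0 ?(ltW r0) ?(ltW rho0) //; lra.
    have h3 := ler_wpM2l (ler0n R (2 * M)) h2.
    by move: h3; rewrite natrM; lra.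
  have p2 : 0 <= 2 * M%:R * r * (1 / r) `^ 2^-1.
    by rewrite !mulr_ge0 ?powR_ge0 ?(ltW r0).
  apply: (@cov_interval _ _ _ 0 _ r0 p2) => x [Ax /=].
  rewrite /large -ltNge -[code_block dig x]cat0s => hx.
  have [Ib b3 Ev xE] := cA _ Ax.
  have hnil : hword I [::] by [].
  have := terminal_interval I_ge2 I_leM hnil Ib b3 Ev r0 hx.
  by rewrite /= -xE wratio_nil.
have cov2 : coverable r A2 (C1 * (M.+1%:R * K) * (r `^ (- t) * rho `^ (2 * t - 1))).
  have [[xA [xA' xbig]]|hno] := pselect (exists x, A x /\ large x); last first.
    exists [::] => [x [Ax bx]|]; first by case: hno; exists x.
    by rewrite /= !mulr_ge0 ?powR_ge0 ?(ltW C10).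
  (* The largest index [n] is sought among large blocks only, where [r] bounds it; the least index
     [m] is sought in all of [A], so that separation can be used against any point. *)
  pose Q k := `[< exists x, [/\ A x, large x & (dig x).1 = k] >].
  pose Q0 k := `[< exists2 x, A x & (dig x).1 = k >].
  have bndQ k : Q k -> (k <= (Num.truncn r^-1).+1)%N.
    move=> /asboolP[x [Ax bx <-]]; have [Ib b3 _ _] := cA _ Ax.
    have := le_trans bx (wratio_blk_le (dig x).1 b3).
    rewrite -[leLHS]invrK lef_pV2 ?posrE ?invr_gt0 ?exprn_gt0 // => h1.
    rewrite -(ler_nat R); apply: ltW; apply: le_lt_trans (truncnS_gt r^-1).
    apply: le_trans h1; apply: (@le_trans _ _ (dig x).1.+1%:R); first by rewrite ler_nat.
    by rewrite expr2 ler_peMl // (ler_nat _ 1).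
  have exQ : exists k, Q k by exists (dig xA).1; apply/asboolP; exists xA.
  have exQ0 : exists k, Q0 k by exists (dig xA).1; apply/asboolP; exists xA.
  case: (ex_maxnP exQ bndQ) => n /asboolP[xn [Axn bxn ltxn]] nmax.
  case: (ex_minnP exQ0) => m /asboolP[xm Axm ltxm] mmin.
  have mn : (m <= n)%N by apply: mmin; apply/asboolP; exists xn.
  have bnd x : A x -> (dig x).1.+2%:R^-1 <= x <= (dig x).1.+1%:R^-1.
    move=> Ax; have [Ib b3 Ev xE] := cA _ Ax; rewrite {2 3}xE.
    by apply: wmap_blk_bounds => //; have := cf_set_01 Ev; lra.
  have h2 : m.+2%:R^-1 - n.+1%:R^-1 <= rho.
    have := bnd _ Axm; have := bnd _ Axn; rewrite ltxm ltxn => /andP[_ hn] /andP[hm _].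
    have := le_trans (ler_norm _) (Adiam _ _ Axm Axn).
    move: hn hm; move: (m.+2%:R^-1) (n.+1%:R^-1) => X Y; lra.
  (* Some point of [A] has a first block different from that of [xm], and [blk_sep] at the least
     index [m] bounds their distance from below. *)
  have h1 : m.+1%:R ^- 2 <= rho / kap.
    rewrite ler_pdivlMr // mulrC.
    have [y Ay ly] : exists2 y, A y & dig xm <> dig y.
      case: Atwo => x [y [Ax Ay xy]]; have [e|e] := pselect (dig xm = dig x); last by exists x.
      by exists y; rewrite // e.
    apply: le_trans (Adiam _ _ Axm Ay).
    have [Ib b3 Ev xE] := cA _ Axm; have [Ib' b3' Ev' yE] := cA _ Ay.
    rewrite xE yE -ltxm; apply: blk_sep => //.
      by rewrite ltxm; apply: mmin; apply/asboolP; exists y.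
    by rewrite -!surjective_pairing; exact/eqP.
  pose F k : R := k.+1%:R `^ (- (1 + (2 * t - 1))).
  have sumF : \sum_(m <= k < n.+1) F k <= K * rho `^ (2 * t - 1).
    by apply: sum_run_le; rewrite ?a0.
  pose L := [seq (k, b) | k <- index_iota m n.+1, b <- iota 0 M.+1].
  pose G := [seq g <- L | `[< exists x, [/\ A x, large x & dig x = g] >]].
  pose P (g : nat * nat) : set R := wmap (blk g.1 g.2) @` E.
  pose N (g : nat * nat) : R := C1 * r `^ (- t) * F g.1.
  have covP g : g \in G -> coverable r (P g) (N g).
    rewrite mem_filter => /andP[/asboolP[x [Ax bx <-]] _].
    have [Ib b3 Ev xE] := cA _ Ax; set g' := dig x in Ib b3 *.
    have w2 : all (leq 2) (blk g'.1 g'.2) by rewrite all_blk ltnW.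
    have L0 := wratio_gt0 R w2; have bx' : r <= wratio R (blk g'.1 g'.2) by [].
    have rL : 0 < r / wratio R (blk g'.1 g'.2) <= 1.
      by rewrite divr_gt0 //= ler_pdivrMr // mul1r.
    have := @cov_wmap R _ _ E _ w2 (fun x Ex => ltW (proj1 (andP (cf_set_01 Ex)))) (hC1 _ rL).
    rewrite mulrCA mulfV ?gt_eqF // mulr1; apply: cov_le.
    have LV : 0 <= (wratio R (blk g'.1 g'.2))^-1 by rewrite invr_ge0 ltW.
    rewrite (powRM _ (ltW r0) LV) /N -mulrA.
    rewrite ler_wpM2l ?(ltW C10) // ler_wpM2l ?powR_ge0 //.
    rewrite -[(wratio _ _)^-1](powR_inv1 (ltW L0)) -powRrM mulN1r opprK.
    have -> : F g'.1 = (g'.1.+1%:R ^- 2) `^ t.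
      by rewrite powR_sqrV //; congr (_ `^ _); ring.
    by rewrite ge0_ler_powR ?nnegrE ?(ltW L0) ?wratio_blk_le //; lra.
  apply: cov_le (cov_bigcup covP _).
    rewrite big_filter.
    apply: (@le_trans _ _ (\sum_(g <- L) N g)).
      rewrite big_mkcond; apply: ler_sum => g _; case: ifP => // _.
      by rewrite /N /F !mulr_ge0 ?powR_ge0 ?(ltW C10).
    rewrite big_allpairs.
    have -> : \sum_(k <- index_iota m n.+1) \sum_(b <- iota 0 M.+1) N (k, b) =
        C1 * r `^ (- t) * M.+1%:R * \sum_(m <= k < n.+1) F k.
      rewrite mulr_sumr; apply: eq_bigr => k _.
      transitivity (\sum_(b <- iota 0 M.+1) C1 * r `^ (- t) * F k); first by [].
      rewrite big_const_seq count_predT size_iota iter_addr_0 -[LHS]mulr_natr.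
      by rewrite -!mulrA [F k * _]mulrC.
    have -> : C1 * (M.+1%:R * K) * (r `^ (- t) * rho `^ (2 * t - 1)) =
      C1 * r `^ (- t) * M.+1%:R * (K * rho `^ (2 * t - 1)) by ring.
    by apply: ler_wpM2l => //; rewrite !mulr_ge0 ?powR_ge0 ?(ltW C10).
  move=> x [Ax bx]; have [Ib b3 Ev xE] := cA _ Ax; exists (dig x); last first.
    by exists (T x).
  rewrite mem_filter; apply/andP; split; first by apply/asboolP; exists x.
  rewrite [dig x]surjective_pairing; apply: allpairs_f.
    rewrite mem_index_iota ltnS; apply/andP; split.
      by apply: mmin; apply/asboolP; exists x.
    by apply: nmax; apply/asboolP; exists x.
  by rewrite mem_iota /= add0n ltnS; exact: I_leM.
pose AA (i : bool) := if i then A1 else A2.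
pose NN (i : bool) : R := if i then (2 * M%:R + 1) * (r `^ (- t) * rho `^ (2 * t - 1))
  else C1 * (M.+1%:R * K) * (r `^ (- t) * rho `^ (2 * t - 1)).
have := @cov_bigcup R bool [:: true; false] AA NN r A.
rewrite !big_cons big_nil addr0 /NN -mulrDl; apply => [[] _ //|x Ax].
have [bx|bx] := boolP (large x); last by exists true.
by exists false.
Qed.

End Coding.
End LocalCount.

Section BallCount.
Variables (R : realType) (I : set nat) (M b0 : nat).
Hypothesis I_ge2 : I `<=` [set n | (2 <= n)%N].
Hypothesis I_leM : I `<=` [set n | (n <= M)%N].
Hypotheses (I_b0 : I b0) (b0_ge3 : (3 <= b0)%N) (I_2 : I 2%N).
Implicit Types (b n : nat) (w u p : seq nat) (x y z t r rho : R).

Local Notation E := (backward_cf_set R I).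
Local Notation digits_ge2 := (digits_ge2 I_ge2).

(** The common code is followed until it splits or its ratio drops below [r]. If the ratio drops
    while the code is still shared, one ball suffices; otherwise the common word [w] is undone and
    [local_count] is used at scale [r / wratio R w]. *)
Lemma ball_count t C1 : 2^-1 < t <= 1 -> 0 < C1 ->
  (forall r, 0 < r <= 1 -> coverable r E (C1 * r `^ (- t))) ->
  exists2 C : R, 0 < C & forall x r rho, E x -> 0 < rho <= 1 -> 0 < r <= rho ^+ 2 ->
    coverable r (ball x rho `&` E) (C * (r `^ (- t) * rho `^ (2 * t - 1))).
Proof.
move=> t21 C10 hC1; have /andP[t2 t1] := t21.
have [dig [T cod]] := coding_exists R I_ge2.
have [C3 C30 hloc] := local_count I_ge2 I_leM I_b0 b0_ge3 I_2 cod t21 C10 hC1.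
exists (1 + C3 * 8 `^ (2 * t - 1)).
  by rewrite addr_gt0 // mulr_gt0 ?powR_gt0.
move=> x r rho Ex /andP[rho0 rho1] /andP[r0 rrho].
have rho21 : rho ^+ 2 <= rho by rewrite expr2 ler_piMr // ltW.
have one_le : 1 <= r `^ (- t) * rho `^ (2 * t - 1).
  apply: (@le_trans _ _ ((rho ^+ 2) `^ (- t) * rho `^ (2 * t - 1))).
    rewrite powR_sqr ?(ltW rho0) // -powRD ?(gt_eqF rho0) ?implybT //.
    rewrite (_ : _ + _ = - 1); last by ring.
    by rewrite powRN powRr1 ?(ltW rho0) // invf_ge1.
  rewrite ler_wpM2r ?powR_ge0 // !powRN lef_pV2 ?posrE ?powR_gt0 ?exprn_gt0 //.
  rewrite ge0_ler_powR ?nnegrE ?exprn_ge0 ?(ltW r0) ?(ltW rho0) //; lra.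
pose A := ball x rho `&` E.
pose share k := `[< forall y, A y -> code dig T k y = code dig T k x >].
have small k : share k -> wratio R (code dig T k x) < r ->
    coverable r A ((1 + C3 * 8 `^ (2 * t - 1)) * (r `^ (- t) * rho `^ (2 * t - 1))).
  move=> /asboolP sh hr; exists [:: x] => [y Ay|]; last first.
    rewrite /= mulrDl mul1r; apply: (le_trans one_le).
    by rewrite lerDl !mulr_ge0 ?powR_ge0 ?(ltW C30).
  exists x; first exact: mem_head.
  have Ey : E y by case: Ay.
  rewrite (pre_wmap cod k Ey) (pre_wmap cod k Ex) (sh _ Ay).
  have [/andP[hw _] _] := hword_pre I_2 cod k Ex.
  have y01 := cf_set_01 (cf_set_iter cod k Ey); have x01 := cf_set_01 (cf_set_iter cod k Ex).
  apply: le_lt_trans (wmap_lip _ _ _) _; [exact: digits_ge2|lra|lra|].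
  apply: le_lt_trans hr; rewrite ler_piMr ?(ltW (wratio_gt0 R (digits_ge2 hw))) //.
  by rewrite ler_norml; lra.
have hex : exists k, ~~ share k || (wratio R (code dig T k x) < r).
  have [k hk] := expn4_lt r0; exists k; apply/orP; right.
  exact: (wratio_pre_lt I_ge2 I_2 cod Ex hk).
case: (ex_minnP hex) => [[|k] hk hmin].
  case/orP: hk => [/asboolPn[] //|]; rewrite /= wratio_nil => r1.
  by have := lt_le_trans r1 (le_trans rrho rho21); rewrite ltNge rho1.
have {hmin} /norP[/negbNE shk] : ~~ (~~ share k || (wratio R (code dig T k x) < r)).
  by apply/negP => /hmin; rewrite ltnn.
rewrite -leNgt => hr.
have [shS|nshS] := boolP (share k.+1).
  by move: hk; rewrite shS /= => hk; exact: small shS hk.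
have /asboolP sh := shk.
set w := code dig T k x in hr.
have [/andP[hw hyw] _] : hword I w /\ rank w = k by exact: (hword_pre I_2 cod).
have w2 := digits_ge2 hw; have L0 := wratio_gt0 R w2; have L1 := wratio_le1 R w2.
pose A' := [set iter k T y | y in A].
have A'E : A' `<=` E by move=> _ [y [_ Ey] <-]; exact: (cf_set_iter cod).
have yE y : A y -> y = wmap w (iter k T y).
  by move=> Ay; have := pre_wmap cod k (proj2 Ay); rewrite (sh _ Ay).
(* The ball has diameter at most [2 * rho], and the distortion contributes the factor 4. *)
have rho8 : 0 < 8 * rho / wratio R w by rewrite divr_gt0 // mulr_gt0.
have diamA' y z : A' y -> A' z -> `|y - z| <= 8 * rho / wratio R w.
  move=> [y' Ay <-] [z' Az <-].
  have y01 := cf_set_01 (A'E _ (ex_intro2 _ _ _ Ay erefl)).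
  have z01 := cf_set_01 (A'E _ (ex_intro2 _ _ _ Az erefl)).
  have := @wmap_colip R w (iter k T y') (iter k T z') hyw; rewrite -!yE // => h.
  have {}h : wratio R w / 4 * `|iter k T y' - iter k T z'| <= `|y' - z'| by apply: h; lra.
  have d2 : `|y' - z'| <= 2 * rho.
    have [] := (Ay.1, Az.1); rewrite /ball /= !ltr_norml => hy hz; rewrite ler_norml; lra.
  rewrite ler_pdivlMr //; move: (le_trans h d2); rewrite mulrAC ler_pdivrMr //.
  by rewrite mulrC; lra.
have rL : 0 < r / wratio R w <= 1 by rewrite divr_gt0 //= ler_pdivrMr // mul1r.
have two : exists y z, [/\ A' y, A' z & dig y <> dig z].
  move: nshS => /asboolPn nsh; apply: contrapT => hn; apply: nsh => y Ay.
  rewrite !preS (sh _ Ay) /code_block.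
  have -> // : dig (iter k T y) = dig (iter k T x).
  apply: contrapT => hne; apply: hn; exists (iter k T y), (iter k T x).
  by split=> //; [exists y|exists x => //; split=> //; exact: ballxx].
have LV0 : 0 < (wratio R w)^-1 by rewrite invr_gt0.
have rL2 : r / wratio R w <= (8 * rho / wratio R w) ^+ 2.
  have -> : (8 * rho / wratio R w) ^+ 2 = 64 * rho ^+ 2 / wratio R w / wratio R w.
    by field; rewrite gt_eqF.
  rewrite (ler_pM2r LV0) ler_pdivlMr //.
  apply: (@le_trans _ _ r); first by rewrite ler_piMr // ltW.
  apply: (le_trans rrho); rewrite expr2; nra.
have := hloc A' _ _ A'E rho8 diamA' two rL rL2.
move=> /(@cov_wmap R w _ A' _ w2 (fun y A'y => ltW (proj1 (andP (cf_set_01 (A'E _ A'y)))))).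
rewrite mulrCA mulfV ?gt_eqF // mulr1 => hc.
apply: (@cov_subset _ _ _ (wmap w @` A')).
  by move=> y Ay; exists (iter k T y); [exists y|rewrite -yE].
apply: cov_le hc.
have LV : 0 <= (wratio R w)^-1 by rewrite invr_ge0 ltW.
rewrite (powRM _ (ltW r0) LV) (powRM _ _ LV) ?mulr_ge0 ?(ltW rho0) //.
rewrite (powRM _ _ (ltW rho0)) //.
have -> : C3 * (r `^ (- t) * (wratio R w)^-1 `^ (- t) *
    (8 `^ (2 * t - 1) * rho `^ (2 * t - 1) * (wratio R w)^-1 `^ (2 * t - 1))) =
  C3 * 8 `^ (2 * t - 1) * (r `^ (- t) * rho `^ (2 * t - 1)) *
  ((wratio R w)^-1 `^ (- t) * (wratio R w)^-1 `^ (2 * t - 1)) by ring.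
rewrite -powRD ?(gt_eqF LV0) ?implybT // -[(wratio R w)^-1](powR_inv1 (ltW L0)) -powRrM.
(* Undoing [w] leaves the factor L^(1 - t), harmless because [t <= 1] and L <= 1. *)
have L01 : wratio R w `^ (-1 * (- t + (2 * t - 1))) <= 1.
  rewrite -[leRHS](powRr0 (wratio R w)); apply: ger_powR; first by rewrite L0.
  by lra.
apply: (@le_trans _ _ (C3 * 8 `^ (2 * t - 1) * (r `^ (- t) * rho `^ (2 * t - 1)))).
  by rewrite ler_piMr // !mulr_ge0 ?powR_ge0 ?(ltW C30).
by rewrite ler_wpM2r ?lerDr // mulr_ge0 ?powR_ge0.
Qed.

End BallCount.

(** * Lower bounds near the parabolic point *)

Section LowerCount.
Variables (R : realType) (I : set nat) (b0 : nat).
Hypothesis I_ge2 : I `<=` [set n | (2 <= n)%N].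
Hypotheses (I_b0 : I b0) (b0_ge3 : (3 <= b0)%N) (I_2 : I 2%N).
Implicit Types (b n : nat) (w u p : seq nat) (x y z s r rho : R).

Local Notation E := (backward_cf_set R I).

(** Pieces at distance at least [2 * r] cannot share a ball of radius [r]; counting pairs of a piece
    and a nearby centre in two ways gives the product. *)
Lemma packing_lower (P : nat -> set R) (J : nat) (B r : R) (A : set R) (l : seq R) :
  (forall j, (j < J)%N -> P j `<=` A) ->
  (forall j j' x y, (j < j' < J)%N -> P j x -> P j' y -> 2 * r <= `|x - y|) ->
  (forall j l, (j < J)%N -> covers r l (P j) -> B <= (size l)%:R) ->
  covers r l A -> J%:R * B <= (size l)%:R.
Proof.
move=> PA Psep PB hl.
pose near_piece j (y : R) := `[< exists2 x, P j x & `|x - y| < r >].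
have h1 j : (j < J)%N -> B <= (count (near_piece j) l)%:R.
  move=> jJ; rewrite -size_filter; apply: (PB j) => // x Px.
  have [y yl xy] := hl x (PA _ jJ _ Px); exists y => //.
  by rewrite mem_filter yl andbT; apply/asboolP; exists x.
have h2 : (\sum_(j < J) count (near_piece j) l <= size l)%N.
  rewrite (eq_bigr (fun j : 'I_J => \sum_(y <- l) near_piece j y)%N); last first.
    by move=> j _; rewrite -sum1_count big_mkcond /=; apply: eq_bigr => y _; case: (near_piece _ _).
  rewrite exchange_big /= -sum1_size; apply: leq_sum => y _.
  have [[j0 hj0]|hn] := pselect (exists j : 'I_J, near_piece j y); last first.
    by rewrite big1 // => j _; case: (boolP (near_piece j y)) => // hj; case: hn; exists j.
  rewrite (bigD1 j0) //= hj0 big1 // => j jj0; apply/eqP; rewrite eqb0; apply/negP => hj.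
  move: hj0 hj => /asboolP[x Px xy] /asboolP[x' Px' xy'].
  have : `|x - x'| < 2 * r.
    by move: xy xy'; rewrite !ltr_norml => xy xy'; lra.
  apply/negP; rewrite -leNgt.
  have [jlt|jlt|/val_inj je] := ltngtP j j0; last by rewrite je eqxx in jj0.
    by rewrite distrC; apply: (Psep j j0) => //; rewrite jlt /=.
  by apply: (Psep j0 j) => //; rewrite jlt /=.
apply: (@le_trans _ _ (\sum_(j < J) (count (near_piece j) l)%:R)).
  rewrite mulr_natl -[X in _ *+ X]card_ord -sumr_const; apply: ler_sum => j _; exact: h1.
by rewrite -natr_sum ler_nat.
Qed.

(** A centre need not lie in the image, so it is replaced by a point of the image within [r]. This
    doubles the radius, and inverting [wmap w] multiplies it by 4 over the ratio. *)
Lemma covers_wmap_inv w r l : hyp w -> 0 < r -> covers r l (wmap w @` E) ->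
  exists2 l', covers (8 * r / wratio R w) l' E & size l' = size l.
Proof.
move=> hw r0 hl.
have [g hg] : {g : R -> R & forall y, (exists2 u, E u & `|wmap w u - y| < r) ->
    E (g y) /\ `|wmap w (g y) - y| < r}.
  apply: (@choice _ _ (fun y v => (exists2 u, E u & `|wmap w u - y| < r) ->
    E v /\ `|wmap w v - y| < r)) => y.
  by have [[u Eu hu]|hn] := pselect (exists2 u, E u & `|wmap w u - y| < r); [exists u|exists 0].
exists (map g l); last by rewrite size_map.
move=> v Ev; have [y yl vy] := hl _ (ex_intro2 _ _ v Ev erefl).
have [Eg gy] := hg y (ex_intro2 _ _ v Ev vy).
exists (g y); first exact: map_f.
have L0 := wratio_gt0 R (hyp_all hw).
have v01 := cf_set_01 Ev; have g01 := cf_set_01 Eg.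
have h : wratio R w / 4 * `|v - g y| <= `|wmap w v - wmap w (g y)| by apply: wmap_colip => //; lra.
have d2 : `|wmap w v - wmap w (g y)| < 2 * r.
  by move: vy gy; rewrite !ltr_norml => vy gy; lra.
rewrite ltr_pdivlMr //; move: (le_lt_trans h d2); rewrite mulrAC ltr_pdivrMr //.
by rewrite mulrC; lra.
Qed.

(** One estimate serves both regimes of q = r / rho^2: pieces of indices between [m] and [2 * m], of
    size about rho^2, are thinned out until they are [2 * r] apart, and each then needs about q^-s
    balls. For large q it is used with [s = 0]. *)
Lemma ball_lower s c : 0 <= s -> 0 < c ->
  (forall r l, 0 < r -> covers r l E -> c * r `^ (- s) <= (size l)%:R) ->
  exists2 c', 0 < c' & forall rho, 0 < rho <= 1 -> exists2 x, E x &
    forall r l, 0 < r -> covers r l (ball x rho `&` E) ->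
      c' * ((rho * (72 * (r / rho ^+ 2) + 2))^-1 * (r / rho ^+ 2) `^ (- s)) <= (size l)%:R.
Proof.
move=> s0 c0 hc.
have bR : (3 : R) <= b0%:R by rewrite ler_nat.
have q0 : 0 < (17 * b0%:R) ^+ 2 :> R by rewrite exprn_gt0 //; lra.
(* 17^2 = 289 exceeds 8 * 36, where 8 comes from [covers_wmap_inv] and 36 from the bound 6 / rho on
   the indices. *)
exists (c * ((17 * b0%:R) ^+ 2) `^ (- s)); first by rewrite mulr_gt0 ?powR_gt0.
move=> rho /andP[rho0 rho1].
have [y0 Ey0] := cf_set_neq0 R I_ge2 I_b0 b0_ge3.
have hblk n : all (mem I) (blk n b0) by exact: all_blkI.
have Eblk n y : E y -> E (wmap (blk n b0) y) by move=> Ey; exact: cf_set_wmap.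
have bnd n y : E y -> n.+2%:R^-1 <= wmap (blk n b0) y <= n.+1%:R^-1.
  by move=> Ey; apply: wmap_blk_bounds => //; have := cf_set_01 Ey; lra.
pose m := (Num.truncn rho^-1).+1.
have rV : 1 <= rho^-1 by rewrite invf_ge1.
have m1 : rho^-1 < m%:R by exact: truncnS_gt.
have m2 : m%:R <= 2 / rho.
  rewrite /m -natr1; have /andP[h _] := truncn_itv (le_trans ler01 rV).
  by lra.
have small n y : (m <= n)%N -> E y -> 0 < wmap (blk n b0) y < rho.
  move=> mn Ey; have /andP[-> _] /= := cf_set_01 (Eblk n _ Ey).
  have /andP[_ h] := bnd n _ Ey; apply: (le_lt_trans h).
  rewrite -[rho]invrK ltf_pV2 ?posrE ?invr_gt0 //; apply: (lt_le_trans m1).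
  by rewrite ler_nat leqW.
have /andP[x0 x1] : 0 < wmap (blk (2 * m) b0) y0 < rho / 2.
  have /andP[-> _] /= := cf_set_01 (Eblk (2 * m)%N _ Ey0).
  have /andP[_ h] := bnd (2 * m)%N _ Ey0; apply: (le_lt_trans h).
  rewrite -[rho / 2]invrK ltf_pV2 ?posrE ?invr_gt0 ?divr_gt0 //.
  have -> : (2 * m).+1%:R = 2 * m%:R + 1 :> R by rewrite -natr1 natrM.
  by rewrite invf_div; lra.
exists (wmap (blk (2 * m) b0) y0); first exact: Eblk.
move=> r l r0 hl.
set q := r / rho ^+ 2.
have q0' : 0 < q by rewrite divr_gt0 ?exprn_gt0.
(* Kept indices are [K] apart. Inverses of numbers up to 6 / rho with index gap at least [K - 1]
   differ by at least (K - 1) rho^2 / 36, which must reach 2 r = 2 q rho^2. *)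
pose K := (Num.truncn (72 * q)).+2.
have /andP[K1 K2] := truncn_itv (mulr_ge0 (ler0n R 72) (ltW q0')).
have KR : (K%:R : R) <= 72 * q + 2.
  by rewrite /K -addn2 natrD; lra.
have KR' : 72 * q <= K%:R - 1.
  by rewrite /K -[(Num.truncn (72 * q)).+2%:R]natr1 addrK ltW.
pose J := (m %/ K).+1.
have JK : (1 / rho) / (72 * q + 2) <= J%:R.
  rewrite ler_pdivrMr; last by lra.
  apply: (@le_trans _ _ (J%:R * K%:R)); last by rewrite ler_wpM2l.
  rewrite div1r; apply: (le_trans (ltW m1)); rewrite -natrM ler_nat.
  by rewrite /J; apply: ltnW; exact: ltn_ceil.
pose P j := wmap (blk (m + j * K) b0) @` E.
have n2m j : (j < J)%N -> (m + j * K <= 2 * m)%N.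
  rewrite /J ltnS => hj; rewrite mul2n -addnn leq_add2l.
  by apply: leq_trans (leq_divM m K); rewrite leq_mul2r hj orbT.
have m6 : 2 * m%:R + 2 <= 6 / rho.
  have h : 2 <= 2 / rho by rewrite ler_pdivlMr //; lra.
  by lra.
have PB j l' : (j < J)%N -> covers r l' (P j) ->
    c * ((17 * b0%:R) ^+ 2 * q) `^ (- s) <= (size l')%:R.
  move=> jJ; have hw : hyp (blk (m + j * K) b0) by rewrite -[blk _ _]cat0s; exact: hyp_blk.
  move=> /(covers_wmap_inv hw r0)[l2 hl2 <-].
  apply: hc; first by rewrite mulr_gt0.
  move=> v /hl2[y yl vy]; exists y => //; apply: (lt_le_trans vy).
  have L0 := wratio_gt0 R (hyp_all hw).
  rewrite ler_pdivrMr //.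
  set n := (m + j * K)%N in L0 *.
  have n0 : 0 <= n%:R :> R by [].
  have nm : (n%:R : R) <= 2 * m%:R by rewrite -natrM ler_nat; exact: n2m.
  have h1 : (b0%:R - 2) * n%:R + (b0%:R - 1) <= b0%:R * (6 / rho) :> R.
    apply: (@le_trans _ _ (b0%:R * (n%:R + 1))); first by nra.
    by rewrite ler_wpM2l //; lra.
  have h0 : 0 < (b0%:R - 2) * n%:R + (b0%:R - 1) :> R by nra.
  have h2 : rho ^+ 2 / (36 * b0%:R ^+ 2) <= wratio R (blk n b0).
    rewrite wratio_blk.
    have -> : rho ^+ 2 / (36 * b0%:R ^+ 2) = (b0%:R * (6 / rho)) ^- 2.
      by field; rewrite !gt_eqF //; lra.
    rewrite lef_pV2 ?posrE ?exprn_gt0 ?(lt_le_trans h0 h1) //.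
    by rewrite ler_sqr ?nnegrE ?(ltW h0) ?(le_trans (ltW h0) h1).
  apply: (@le_trans _ _ ((17 * b0%:R) ^+ 2 * q * (rho ^+ 2 / (36 * b0%:R ^+ 2)))).
    have -> : (17 * b0%:R) ^+ 2 * q * (rho ^+ 2 / (36 * b0%:R ^+ 2)) = 289 / 36 * r.
      by rewrite /q; field; rewrite !gt_eqF //; lra.
    by rewrite ler_pM2r //; lra.
  by apply: ler_wpM2l h2; rewrite ltW // mulr_gt0.
have sep j j' x y : (j < j' < J)%N -> P j x -> P j' y -> 2 * r <= `|x - y|.
  move=> /andP[jj' j'J] [u Eu <-] [v Ev <-].
  have /andP[h1 _] := bnd (m + j * K)%N _ Eu; have /andP[_ h2] := bnd (m + j' * K)%N _ Ev.
  apply: le_trans (ler_norm _); apply: le_trans (lerB h1 h2).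
  have nn : (m + j * K + K <= m + j' * K)%N.
    by rewrite -addnA leq_add2l addnC -mulSn leq_mul2r jj' orbT.
  have n'2 := n2m _ j'J.
  move: (m + j * K)%N (m + j' * K)%N nn n'2 => n n' nn n'2.
  have nnR : (n%:R + K%:R : R) <= n'%:R by rewrite -natrD ler_nat.
  have n'R : (n'%:R : R) <= 2 * m%:R by rewrite -natrM ler_nat.
  have n0 : 0 <= n%:R :> R by [].
  rewrite -[n.+2%:R]natr1 -[n.+1%:R]natr1 -[n'.+1%:R]natr1.
  have -> : 2 * r = 2 * q * rho ^+ 2 by rewrite /q; field; rewrite gt_eqF.
  have K0 : 1 <= (K%:R : R) by rewrite (ler_nat _ 1).
  move: (n%:R : R) (n'%:R : R) (m%:R : R) (K%:R : R) n0 nnR n'R m6 KR' K0.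
  move=> X Y Z k X0 XY YZ Z6 kq k1.
  have X2 : 0 < X + 1 + 1 by lra.
  have Y1 : 0 < Y + 1 by lra.
  have -> : (X + 1 + 1)^-1 - (Y + 1)^-1 = (Y - X - 1) / ((X + 1 + 1) * (Y + 1)).
    by field; rewrite !gt_eqF.
  rewrite ler_pdivlMr ?mulr_gt0 //.
  have D : (X + 1 + 1) * (Y + 1) <= (6 / rho) * (6 / rho) by apply: ler_pM; lra.
  apply: (@le_trans _ _ (2 * q * rho ^+ 2 * (6 / rho * (6 / rho)))).
    by apply: ler_wpM2l D; rewrite (mulr_ge0 (mulr_ge0 _ (ltW q0'))) ?exprn_ge0 ?(ltW rho0).
  have -> : 2 * q * rho ^+ 2 * (6 / rho * (6 / rho)) = 72 * q.
    by field; rewrite gt_eqF.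
  by lra.
have PA j : (j < J)%N -> P j `<=` ball (wmap (blk (2 * m) b0) y0) rho `&` E.
  move=> jJ _ [v Ev <-]; split; last exact: Eblk.
  have := small (m + j * K)%N _ (leq_addr _ _) Ev.
  move: x0 x1; move: (wmap (blk (2 * m) b0) y0) (wmap _ v) => a d a0 a1 d01.
  by rewrite /ball /= ltr_norml; lra.
apply: le_trans (packing_lower PA sep PB hl).
rewrite (powRM _ (ltW q0) (ltW q0')) invfM.
have B0 : 0 <= c * (((17 * b0%:R) ^+ 2) `^ (- s) * q `^ (- s)).
  by rewrite !mulr_ge0 ?powR_ge0 ?(ltW c0).
have := ler_wpM2r B0 JK; apply: le_trans.
by rewrite le_eqVlt; apply/orP; left; apply/eqP; rewrite div1r; ring.
Qed.

End LowerCount.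

(** * Dimensions *)

Section Exponents.
Variable R : realType.
Implicit Types (c C e r : R).

Lemma near_powR_ge e C : 0 < e -> \forall r \near 0^'+, C <= r `^ (- e).
Proof.
move=> e0; pose C' := Num.max C 1.
have C0 : 0 < C' by rewrite lt_max ltr01 orbT.
have d0 : 0 < C' `^ (- e^-1) by exact: powR_gt0.
near=> r; have r0 : 0 < r by near: r; exact: nbhs_right_gt.
have rd : r <= C' `^ (- e^-1) by near: r; exact: nbhs_right_le.
apply: (@le_trans _ _ C'); first by rewrite le_max lexx.
have -> : C' = (C' `^ (- e^-1)) `^ (- e).
  by rewrite -powRrM mulrNN mulVf ?gt_eqF // powRr1 // ltW.
rewrite [leLHS]powRN [leRHS]powRN lef_pV2 ?posrE ?powR_gt0 //.
by apply: ge0_ler_powR; rewrite ?nnegrE // ltW.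
Unshelve. all: by end_near. Qed.

(** Otherwise r^-(e2 - e1) would stay bounded as r tends to 0. *)
Lemma exponent_le c C e1 e2 : 0 < c ->
  (forall r, 0 < r <= 1 -> c * r `^ e1 <= C * r `^ e2) -> e2 <= e1.
Proof.
move=> c0 h; rewrite leNgt; apply/negP => e12.
have e0 : 0 < e2 - e1 by lra.
have [r [r01 hr]] : exists r, 0 < r <= 1 /\ C / c + 1 <= r `^ (- (e2 - e1)).
  apply: (@filter_ex _ (0 : R)^'+).
  near=> r; split; last by near: r; exact: near_powR_ge.
  by apply/andP; split; near: r; [exact: nbhs_right_gt|exact: nbhs_right_le].
have r0 : 0 < r by case/andP: r01.
have p2 : 0 < r `^ e2 by exact: powR_gt0.
have := h _ r01; have -> : r `^ e1 = r `^ (- (e2 - e1)) * r `^ e2.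
  by rewrite -powRD ?(gt_eqF r0) ?implybT //; congr (_ `^ _); ring.
rewrite mulrA ler_pM2r // mulrC -ler_pdivlMr //; lra.
Unshelve. all: by end_near. Qed.

Lemma covering_number_ge0 r (A : set R) : (0 <= covering_number r A)%E.
Proof. exact: covering_number_ge. Qed.

Lemma lee_lne0 (x y : \bar R) : (0 <= x)%E -> (0 <= y)%E ->
  (lne x <= lne y)%E = (x <= y)%E.
Proof. by move=> x0 y0; rewrite lee_lne // in_itv /= ?x0 ?y0 leey. Qed.

End Exponents.

Section Dimensions.
Variables (R : realType) (I : set nat) (M b0 : nat).
Hypothesis I_ge2 : I `<=` [set n | (2 <= n)%N].
Hypothesis I_leM : I `<=` [set n | (n <= M)%N].
Hypotheses (I_b0 : I b0) (b0_ge3 : (3 <= b0)%N) (I_2 : I 2%N).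
Implicit Types (s t r rho alpha theta : R).

Local Notation E := (backward_cf_set R I).
Local Notation h := (hausdorff_dim E).

Let E0 : E !=set0 := cf_set_neq0 R I_ge2 I_b0 b0_ge3.

Lemma cov_above_dim t : (h < t%:E)%E ->
  exists2 C : R, 0 < C & forall r, 0 < r <= 1 -> coverable r E (C * r `^ (- t)).
Proof.
move=> ht; have h2 := hausdorff_dim_ge_half R I_ge2 I_leM I_b0 b0_ge3 I_2.
have {h2} [k hk k2] : exists2 k : R, h = k%:E & 2^-1 <= k.
  by case: h h2 ht => [k||] //; rewrite ?lee_fin // => ? _; exists k.
rewrite hk lte_fin in ht.
(* The midpoint of [k] and [t] leaves room on both sides: above the dimension for the bound at each
   rank, below [t] for summing over ranks. *)
have [||D D0 hD] := @sum_words_le R I M b0 I_ge2 I_leM I_b0 b0_ge3 I_2 ((k + t) / 2) t.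
- by rewrite hk lte_fin; lra.
- by lra.
have [dig [T cod]] := coding_exists R I_ge2.
exists ((2 * M%:R + 1) * D); first by rewrite mulr_gt0 // ltr_wpDl // mulr_ge0.
by move=> r r01; apply: (upper_count I_ge2 I_leM I_2 cod) => //; lra.
Qed.

(** The upper bound compares the lower count below the dimension with the cover of the unit interval
    by about 1/r balls. *)
Lemma hausdorff_dim_real : exists2 k : R, h = k%:E & 2^-1 <= k <= 1.
Proof.
have h2 := hausdorff_dim_ge_half R I_ge2 I_leM I_b0 b0_ge3 I_2.
have h1 : (h <= 1%:E)%E.
  rewrite leNgt; apply/negP => h1.
  have [s s1 hs] : exists2 s : R, 1 < s & (s%:E < h)%E.
    case: h h1 => [k||//] h1; last by exists 2; rewrite ?ltry //; lra.
    by exists ((1 + k) / 2); rewrite ?lte_fin in h1 *; lra.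
  have [|c /andP[c0 _] hc] := covers_lower_bound E0 _ hs; first by lra.
  suff : s <= 1 by lra.
  rewrite -lerN2; apply: (@exponent_le _ c 2) => // r /andP[r0 r1].
  have [|l hl hN] := @cov_interval R r E 0 1 r0 ler01.
    by move=> x /cf_set_01; lra.
  apply: le_trans (hc _ _ r0 hl) _; apply: (le_trans hN).
  have : 1 <= r^-1 by rewrite invf_ge1.
  by rewrite (powR_inv1 (ltW r0)) div1r; lra.
case: h h1 h2 => [k||] //; rewrite !lee_fin => k1 k2.
by exists k; rewrite ?k2.
Qed.

(** Counts from above hold for exponents over [h], counts from below for exponents under [h]; half
    of [e] moves the exponent and the other half absorbs the constant at small radii. *)
Lemma upper_box_dim_cf_set : upper_box_dim E = h.
Proof.
have [k hk k01] := hausdorff_dim_real; rewrite hk.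
have lnr r : 0 < r < 1 -> 0 < (- ln r)^-1 by move=> ?; rewrite invr_gt0 oppr_gt0 ln_lt0.
have lnp r t : 0 < r < 1 -> ((ln (r `^ (- t)))%:E * ((- ln r)^-1)%:E = t%:E)%E.
  move=> r01; rewrite -EFinM ln_powR mulNr -mulrN mulfK //.
  by have := lnr _ r01; rewrite invr_gt0 => /gt_eqF ->.
apply/eqP; rewrite eq_le; apply/andP; split.
  apply/lee_addgt0Pr => e e0.
  have [|C C0 hC] := @cov_above_dim (k + e / 2); first by rewrite hk lte_fin; lra.
  pose V := [set r : R | 0 < r < 1 /\ C <= r `^ (- (e / 2))].
  have V0 : (0^'+ : set_system R) V.
    rewrite /V; near=> r; split; last by near: r; apply: near_powR_ge; lra.
    by apply/andP; split; near: r; [exact: nbhs_right_gt|exact: nbhs_right_lt].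
  apply: le_trans (ereal_inf_lbound _) _; first by exists V.
  apply: ge_ereal_sup => _ [r [r01 hr] <-]; have r0 : 0 < r by case/andP: r01.
  rewrite -EFinD -(lnp r (k + e) r01); apply: lee_wpmul2r.
    by rewrite lee_fin ltW // lnr.
  rewrite -lne_EFin ?powR_gt0 // lee_lne0 ?lee_fin ?powR_ge0 ?covering_number_ge0 //.
  have r01' : 0 < r <= 1 by lra.
  apply: (le_trans (covering_number_le (hC _ r01'))); rewrite lee_fin.
  apply: (@le_trans _ _ (r `^ (- (e / 2)) * r `^ (- (k + e / 2)))).
    by rewrite ler_wpM2r ?powR_ge0.
  rewrite -powRD ?(gt_eqF r0) ?implybT // le_eqVlt; apply/orP; left; apply/eqP.
  by congr (_ `^ _); field.
apply/lee_addgt0Pr => e e0; rewrite -leeBlDr // -EFinB.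
pose s := Num.max 0 (k - e / 2).
have s0 : 0 <= s by rewrite le_max lexx.
have sk : s < k by rewrite gt_max; lra.
have sle : k - e <= s - e / 2.
  have : k - e / 2 <= s by rewrite le_max lexx orbT.
  by lra.
have [|c /andP[c0 _] hc] := @covers_lower_bound R s E E0 s0; first by rewrite hk lte_fin.
apply: le_ereal_inf_tmp => _ [V V0 <-].
have [r [[r01 hr] Vr]] : exists r, (0 < r < 1 /\ c^-1 <= r `^ (- (e / 2))) /\ V r.
  apply: (@filter_ex _ (0^'+ : set_system R)); apply: filterI => //.
  near=> r; split; last by near: r; apply: near_powR_ge; lra.
  by apply/andP; split; near: r; [exact: nbhs_right_gt|exact: nbhs_right_lt].
have r0 : 0 < r by case/andP: r01.
apply: (@le_trans _ _ (lne (covering_number r E) * ((- ln r)^-1)%:E)%E); last first.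
  by apply: ereal_sup_ubound; exists r.
rewrite -(lnp r (k - e) r01); apply: lee_wpmul2r.
  by rewrite lee_fin ltW // lnr.
rewrite -lne_EFin ?powR_gt0 // lee_lne0 ?lee_fin ?powR_ge0 ?covering_number_ge0 //.
apply: covering_number_ge => l hl; apply: le_trans (hc _ _ r0 hl).
apply: (@le_trans _ _ (r `^ (e / 2) * r `^ (- s))); last first.
  rewrite ler_wpM2r ?powR_ge0 // -[c]invrK -[r `^ (e / 2)]invrK.
  by rewrite lef_pV2 ?posrE ?invr_gt0 ?powR_gt0 // -powRN.
rewrite -powRD ?(gt_eqF r0) ?implybT // ger_powR //; first by rewrite r0; lra.
by lra.
Unshelve. all: by end_near. Qed.

End Dimensions.

(** * The Assouad spectrum for positive parameters *)

Section AssouadSpectrum.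
Variables (R : realType) (I : set nat) (M b0 : nat).
Hypothesis I_ge2 : I `<=` [set n | (2 <= n)%N].
Hypothesis I_leM : I `<=` [set n | (n <= M)%N].
Hypotheses (I_b0 : I b0) (b0_ge3 : (3 <= b0)%N) (I_2 : I 2%N).
Implicit Types (s t r rho alpha theta : R).

Local Notation E := (backward_cf_set R I).
Local Notation h := (hausdorff_dim E).

Let E0 : E !=set0 := cf_set_neq0 R I_ge2 I_b0 b0_ge3.

Lemma assouad_spectrum_neq0 theta : 0 < theta ->
  assouad_spectrum theta E = ereal_inf [set alpha%:E | alpha in [set alpha : R |
    exists C : R, (0 < C)%R /\
      forall x : R, E x -> forall rho : R, (0 < rho <= 1)%R ->
        (covering_number (rho `^ theta^-1) (ball x rho `&` E)
          <= (C * rho `^ (alpha * (1 - theta^-1)))%:E)%E]].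
Proof. by move=> t0; rewrite /assouad_spectrum gt_eqF. Qed.

Lemma assouad_spectrum_le1 theta : 0 < theta < 1 -> (assouad_spectrum theta E <= 1)%E.
Proof.
move=> /andP[t0 t1]; rewrite assouad_spectrum_neq0 //; apply: ereal_inf_lbound.
(* The ball has length [2 * rho], which needs [2 * rho / r + 1] balls, and [rho / r] is at least
   1. *)
exists 1 => //; exists 3; split=> // x Ex rho /andP[r0 r1].
have p0 : 0 < rho `^ theta^-1 by exact: powR_gt0.
have tV : 1 <= theta^-1 by rewrite invf_ge1 // ltW.
have E1 : rho `^ (1 * (1 - theta^-1)) = rho / rho `^ theta^-1.
  by rewrite mul1r (@powRB _ rho 1) ?(gt_eqF r0) ?implybT // powRr1 // ltW.
have ge1 : 1 <= rho / rho `^ theta^-1.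
  by rewrite ler_pdivlMr // mul1r ge1r_powR // r0.
apply: covering_number_le; rewrite E1.
apply: (@cov_le _ _ _ (2 * rho / rho `^ theta^-1 + 1)).
  by rewrite -mulrA; lra.
apply: (@cov_interval _ _ _ (x - rho)) => //; first by rewrite mulr_ge0 // ltW.
by move=> y [+ _]; rewrite /ball /= ltr_norml; lra.
Qed.

(** With r = rho^(1/theta) the count r^-t rho^(2t-1) is a power of rho, and alpha solves alpha (1 -
    1/theta) = 2 t - 1 - t/theta. The condition theta < 1/2 yields r <= rho^2. *)
Lemma assouad_spectrum_le theta t : 0 < theta < 2^-1 -> (h < t%:E)%E -> t <= 1 ->
  (assouad_spectrum theta E <= ((theta + t * (1 - 2 * theta)) / (1 - theta))%:E)%E.
Proof.
move=> /andP[th0 th2] ht t1; rewrite assouad_spectrum_neq0 //; apply: ereal_inf_lbound.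
set alpha : R := _ / _; exists alpha => //.
have [C1 C10 hC1] := cov_above_dim I_ge2 I_leM I_b0 b0_ge3 I_2 ht.
have t2 : 2^-1 < t <= 1.
  have [k hk k2] := hausdorff_dim_real R I_ge2 I_leM I_b0 b0_ge3 I_2.
  by move: ht; rewrite hk lte_fin; lra.
have [C C0 hC] := ball_count I_ge2 I_leM I_b0 b0_ge3 I_2 t2 C10 hC1.
exists C; split=> // x Ex rho /andP[r0 r1].
have tV : 2 <= theta^-1 by rewrite -[2]invrK lef_pV2 ?posrE //; lra.
have -> : rho `^ (alpha * (1 - theta^-1)) =
    (rho `^ theta^-1) `^ (- t) * rho `^ (2 * t - 1).
  rewrite -powRrM -powRD ?(gt_eqF r0) ?implybT //; congr (_ `^ _).
  by rewrite /alpha; field; rewrite !gt_eqF //; lra.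
apply: covering_number_le; apply: hC => //; first by rewrite r0.
rewrite powR_gt0 //= -powR_mulrn ?(ltW r0) // ger_powR // r0 //.
Qed.

(** Substituting r = rho^(1/theta), hence q = rho^(1/theta - 2), turns an admissible exponent into
    an inequality between functions of rho alone. *)
Lemma assouad_spectrum_lower theta alpha s c : 0 < theta < 1 -> 0 <= s -> 0 < c ->
  (forall r l, 0 < r -> covers r l E -> c * r `^ (- s) <= (size l)%:R) ->
  (exists C : R, (0 < C)%R /\
      forall x : R, E x -> forall rho : R, (0 < rho <= 1)%R ->
        (covering_number (rho `^ theta^-1) (ball x rho `&` E)
          <= (C * rho `^ (alpha * (1 - theta^-1)))%:E)%E) ->
  exists c' C : R, 0 < c' /\ forall rho, 0 < rho <= 1 ->
    c' * ((rho * (72 * rho `^ (theta^-1 - 2) + 2))^-1 * rho `^ (- (s * (theta^-1 - 2))))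
      <= C * rho `^ (alpha * (1 - theta^-1)).
Proof.
move=> th01 s0 c0 hc [C [C0 hC]].
have [c' c'0 hc'] := ball_lower I_ge2 I_b0 b0_ge3 I_2 s0 c0 hc.
exists c', C; split=> // rho r01; have /andP[r0 r1] := r01.
have [x Ex hx] := hc' _ r01.
have := hC _ Ex _ r01; rewrite -lee_fin; apply: le_trans.
apply: covering_number_ge => l hl; apply: le_trans (hx _ _ (powR_gt0 _ r0) hl).
have -> : rho `^ theta^-1 / rho ^+ 2 = rho `^ (theta^-1 - 2).
  by rewrite powRB ?(gt_eqF r0) ?implybT // powR_mulrn // ltW.
by rewrite -powRrM mulrN [(theta^-1 - 2) * s]mulrC.
Qed.

Lemma assouad_spectrum_ge theta s : 0 < theta < 2^-1 -> 0 <= s -> (s%:E < h)%E ->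
  (((theta + s * (1 - 2 * theta)) / (1 - theta))%:E <= assouad_spectrum theta E)%E.
Proof.
move=> /andP[th0 th2] s0 hs; rewrite assouad_spectrum_neq0 //.
apply: le_ereal_inf_tmp => _ [alpha ha <-]; rewrite lee_fin.
have [c /andP[c0 _] hc] := covers_lower_bound E0 s0 hs.
have th01 : 0 < theta < 1 by lra.
have [c' [C [c'0 hC]]] := assouad_spectrum_lower th01 s0 c0 hc ha.
have tV : 2 <= theta^-1 by rewrite -[2]invrK lef_pV2 ?posrE //; lra.
have : alpha * (1 - theta^-1) <= - 1 - s * (theta^-1 - 2).
  (* Here q = rho^(1/theta - 2) is at most 1, so 72 q + 2 <= 74. *)
  apply: (@exponent_le _ (c' / 74) C) => [|rho r01]; first by rewrite divr_gt0.
  have /andP[r0 r1] := r01; apply: le_trans (hC _ r01).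
  have q1 : rho `^ (theta^-1 - 2) <= 1.
    by rewrite -[leRHS](powRr0 rho) ger_powR ?r0 //; lra.
  have q0 : 0 < rho `^ (theta^-1 - 2) by exact: powR_gt0.
  rewrite powRD ?(gt_eqF r0) ?implybT // -mulrA ler_pM2l // mulrA.
  rewrite ler_wpM2r ?powR_ge0 // (powR_inv1 (ltW r0)) -invfM lef_pV2 ?posrE ?mulr_gt0 //; last by lra.
  by rewrite mulrC ler_pM2r //; lra.
move=> h1; have {h1} := ler_wpM2r (ltW th0) h1.
have -> : alpha * (1 - theta^-1) * theta = alpha * theta - alpha.
  by field; rewrite gt_eqF.
have -> : (- 1 - s * (theta^-1 - 2)) * theta = - theta - s + 2 * (s * theta).
  by field; rewrite gt_eqF.
by rewrite ler_pdivrMr; lra.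
Qed.

Lemma assouad_spectrum_ge1 theta : 2^-1 <= theta < 1 -> (1 <= assouad_spectrum theta E)%E.
Proof.
move=> /andP[th2 th1]; have th0 : 0 < theta by lra.
have th01 : 0 < theta < 1 by rewrite th0.
rewrite assouad_spectrum_neq0 //.
apply: le_ereal_inf_tmp => _ [alpha ha <-]; rewrite lee_fin.
(* Exponent 0 uses only that each piece needs at least one ball: when r >= rho^2 the separated
   pieces alone give the full count. *)
have h0 r l : 0 < r -> covers r l E -> 1 * r `^ (- 0) <= (size l)%:R.
  move=> _ hl; rewrite oppr0 powRr0 mulr1 (ler_nat _ 1).
  by case: E0 => x /hl[y]; case: l {hl}.
have [c' [C [c'0 hC]]] := assouad_spectrum_lower th01 (lexx 0) ltr01 h0 ha.
have tV : theta^-1 <= 2 by rewrite -[leRHS]invrK lef_pV2 ?posrE //; lra.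
have : alpha * (1 - theta^-1) <= 1 - theta^-1.
  (* Now q >= 1, so 72 q + 2 <= 74 q. *)
  apply: (@exponent_le _ (c' / 74) C) => [|rho r01]; first by rewrite divr_gt0.
  have /andP[r0 r1] := r01; apply: le_trans (hC _ r01).
  have q1 : 1 <= rho `^ (theta^-1 - 2).
    by rewrite -[leLHS](powRr0 rho) ger_powR ?r0 //; lra.
  have -> : rho `^ (1 - theta^-1) = (rho * rho `^ (theta^-1 - 2))^-1.
    rewrite -[X in X * _](powRr1 (ltW r0)) -powRD ?(gt_eqF r0) ?implybT // -powRN.
    by congr (_ `^ _); ring.
  rewrite mul0r oppr0 powRr0 mulr1 -mulrA ler_pM2l // -invfM.
  rewrite lef_pV2 ?posrE ?mulr_gt0 //; try lra.
  by rewrite mulrCA ler_pM2l //; lra.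
have tV1 : 1 < theta^-1 by rewrite invf_gt1.
by rewrite ger_nMl; lra.
Qed.

Lemma assouad_spectrum_cf_set theta : 0 <= theta < 1 ->
  assouad_spectrum theta E =
    (if (theta < 1 / 2)%R then h + (theta / (1 - theta))%:E * (1 - h) else 1)%E.
Proof.
move=> /andP[th0 th1].
have [k hk /andP[k2 k1]] := hausdorff_dim_real R I_ge2 I_leM I_b0 b0_ge3 I_2.
rewrite hk; have -> : 1 / 2 = 2^-1 :> R by rewrite div1r.
have [thlt|thge] := ltP theta 2^-1; last first.
  apply/eqP; rewrite eq_le.
  rewrite assouad_spectrum_le1 ?assouad_spectrum_ge1 ?thge //.
  by rewrite th1 andbT; lra.
rewrite -EFinB -EFinM -EFinD.
have := th0; rewrite le_eqVlt => /predU1P[th00|thp].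
  rewrite /assouad_spectrum -th00 eqxx mul0r mul0r addr0.
  by rewrite (upper_box_dim_cf_set R I_ge2 I_leM I_b0 b0_ge3 I_2).
have -> : k + theta / (1 - theta) * (1 - k) = (theta + k * (1 - 2 * theta)) / (1 - theta).
  by field; rewrite gt_eqF //; lra.
(* The formula is affine in the exponent with slope (1 - 2 theta)/(1 - theta), between 0 and 1, so
   an error [e] in the dimension costs at most [e]. *)
have slope u v e : u <= v + e -> 0 <= e ->
    (theta + u * (1 - 2 * theta)) / (1 - theta) <= (theta + v * (1 - 2 * theta)) / (1 - theta) + e.
  move=> uv e0; rewrite ler_pdivrMr; last by lra.
  rewrite [leRHS]mulrDl divfK; last by rewrite gt_eqF //; lra.
  by nra.
have thr : 0 < theta < 2^-1 by rewrite thp.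
apply/eqP; rewrite eq_le; apply/andP; split; apply/lee_addgt0Pr => e e0.
  have [k1'|kn1] := ltP k 1; last first.
    (* When the dimension is 1 no exponent [t] satisfies h < t <= 1, but the claimed value is 1 and
       the general bound applies. *)
    have -> : k = 1 by lra.
    have -> : (theta + 1 * (1 - 2 * theta)) / (1 - theta) = 1.
      by field; rewrite gt_eqF //; lra.
    apply: le_trans (assouad_spectrum_le1 _) _; first by rewrite thp.
    by rewrite -EFinD lee_fin; lra.
  pose t := Num.min ((k + 1) / 2) (k + e).
  have kt : k < t by rewrite lt_min; lra.
  have t1 : t <= 1.
    have : t <= (k + 1) / 2 by rewrite ge_min lexx.
    by lra.
  apply: le_trans (assouad_spectrum_le thr _ t1) _.
    by rewrite hk lte_fin.
  by rewrite -EFinD lee_fin; apply: slope (ltW e0); rewrite ge_min lexx orbT.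
pose s := Num.max 0 (k - e).
have s0 : 0 <= s by rewrite le_max lexx.
have sk : s < k by rewrite gt_max; lra.
apply: (@le_trans _ _ (((theta + s * (1 - 2 * theta)) / (1 - theta))%:E + e%:E)%E).
  rewrite -EFinD lee_fin; apply: slope (ltW e0); rewrite -lerBlDr.
  by rewrite le_max lexx orbT.
rewrite leeD2r //; apply: (assouad_spectrum_ge thr s0).
by rewrite hk lte_fin.
Qed.

End AssouadSpectrum.

Local Open Scope ereal_scope.

Theorem corollary6p7 (R : realType) (I : set nat) (theta : R)
    (I_ge2 : I `<=` [set n | (2 <= n)%N])
    (I_fin : finite_set I)
    (I_2 : I 2%N)
    (I_neq2 : I <> [set 2%N])
    (theta_01 : (0 <= theta < 1)%R) :
  let h := hausdorff_dim (backward_cf_set R I) in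
  assouad_spectrum theta (backward_cf_set R I) =
    if (theta < 1 / 2)%R then h + (theta / (1 - theta))%:E * (1 - h) else 1.
Proof.
have [M I_leM] : exists M, I `<=` [set n | (n <= M)%N].
  have [X IX] := iffLR (finite_seqP _) I_fin.
  by exists (\max_(i <- X) i)%N => n; rewrite IX => nX; exact: leq_bigmax_seq.
have [b0 Ib0 b3] : exists2 b0, I b0 & (3 <= b0)%N.
  apply: contrapT => hn; apply: I_neq2; apply/seteqP; split=> [b Ib|b -> //].
  have := I_ge2 _ Ib; rewrite /= leq_eqVlt => /predU1P[->//|b3].
  by case: hn; exists b.
exact: (assouad_spectrum_cf_set I_ge2 I_leM Ib0 b3 I_2 theta_01).
Qed.
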